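(* Let $\mathcal{C}$ be a monotonically growing temporal cycle. Let $x$ be a paramount vertex of $\mathcal{C}$, $y$ a paramount response to $x$, and $z$ a paramount response to $y$. Then $(x,y)$ or $(y,z)$ is a Nash equilibrium of the two-player temporal Voronoi game on $\mathcal{C}$.
   Context: A monotonically growing temporal cycle $\mathcal{C}=(V,(E_t)_{t=1}^\infty)$ has vertex set $V=\{0,\dots,n-1\}$, edge sets $E_1\subseteq E_2\subseteq\cdots$ that are eventually constant, and $\bigcup_t E_t$ is the edge set of the cycle $0,1,\dots,n-1$ in this cyclic order. For $x\in\mathbb{Z}$, $\underline{x}\in V$ denotes its residue modulo $n$. The appearance time of an edge $e$ is $\tau_e=\min\{t\ge1: e\in E_t\}$. A temporal walk from $v_0$ to $v_d$ is a sequence $(\{v_0,v_1\},t_1),\dots,(\{v_{d-1},v_d\},t_d)$ with $t_1<\dots<t_d$ and $\{v_{i-1},v_i\}\in E_{t_i}$; its arrival time is $t_d$. $\mathrm{td}(u,v)$ is the smallest arrival time of a temporal walk from $u$ to $v$, with $\mathrm{td}(v,v)=0$. $\Omega^t(v)=\{w:\mathrm{td}(v,w)\le t\}$. Two-player temporal Voronoi game: players $1,2$ choose $p_1,p_2\in V$; the payoff of player $i$ is the number of vertices $v$ with $\mathrm{td}(p_i,v)<\mathrm{td}(p_j,v)$, $j\neq i$. A vertex is a best response to the opponent's vertex if it maximizes the player's own payoff among all vertices of $V$; $(p_1,p_2)$ is a Nash equilibrium if $p_1$ and $p_2$ are best responses to each other. Step counts: for a vertex $v$, $\omega_<^t(v)=\omega_>^t(v)=0$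 for $t\le 0$. For $t>0$: $\omega_<^t(v)=\omega_<^{t-1}(v)$ if $t<\tau_{\{\underline{v-\omega_<^{t-1}(v)-1},\,\underline{v-\omega_<^{t-1}(v)}\}}$ and $\omega_<^t(v)=\omega_<^{t-1}(v)+1$ otherwise; $\omega_>^t(v)=\omega_>^{t-1}(v)$ if $t<\tau_{\{\underline{v+\omega_>^{t-1}(v)},\,\underline{v+\omega_>^{t-1}(v)+1}\}}$ and $\omega_>^t(v)=\omega_>^{t-1}(v)+1$ otherwise. Set $\omega^t(v)=1+\omega_<^t(v)+\omega_>^t(v)$. For vertices $v,w$ let $\bar t(v,w)$ be the first time $t$ at which $\Omega^{t}(v)$ and $\Omega^{t}(w)$ are comparable under inclusion. For integer sequences, $(a^i)_i>(b^i)_i$ (colexicographic order) means that there is $i$ with $a^i>b^i$ and $a^j\ge b^j$ for all $j>i$. Write $v\succ w$ if $(\omega^t(v))_{t=\bar t(v,w)}^\infty>(\omega^t(w))_{t=\bar t(v,w)}^\infty$, $v\sim w$ if these two sequences are equal, and $v\succsim w$ if $v\succ w$ or $v\sim w$. A vertex $v$ is paramount if $v\succsim w$ for all other vertices $w$. A vertex $w$ is a paramount response to $v$ if $w$ is a best response to $v$ (in the Voronoi game) and $w\succsim w'$ for all other best responses $w'$ to $v$. *)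

(* Defs.v *)
From mathcomp Require Import all_boot all_order all_algebra.
From mathcomp Require Import boolp.

Set Implicit Arguments.
Unset Strict Implicit.
Unset Printing Implicit Defensive.

Import GRing.Theory.
Local Open Scope nat_scope.

(* For [1 < n] the ring ['Z_n] is {0, ..., n-1} with arithmetic modulo n, so
   the residue of [v + k] modulo n is [(v + k%:R)%R]. *)
Definition cedge n (i : 'Z_n) : {set 'Z_n} := [set i; (i + 1)%R].

(* Time starts at 1: the value [snapshot 0] is never used. *)
Record growing_tcycle (n : nat) := TCycle {
  snapshot :> nat -> {set {set 'Z_n}};
  tcycle_gt2 : 2 < n;
  tcycle_mono : forall t, 0 < t -> snapshot t \subset snapshot t.+1;
  tcycle_stable : exists2 s, 0 < s & forall t, s <= t -> snapshot t = snapshot s;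
  tcycle_union : forall e : {set 'Z_n},
    (exists2 t, 0 < t & e \in snapshot t) <-> (exists i, e = cedge i)
}.

Section TemporalCycle.
Variables (n : nat) (C : growing_tcycle n).
Implicit Types (u v w : 'Z_n) (t : nat).

Lemma appearsP (i : 'Z_n) : exists t, (0 < t) && (cedge i \in C t).
Proof.
have [_ /(_ (ex_intro _ i erefl)) [t t0 it]] := tcycle_union C (cedge i).
by exists t; rewrite t0.
Qed.

(* Appearance time of the edge {i, i + 1}. *)
Definition tau (i : 'Z_n) : nat := ex_minn (appearsP i).

(* The walk ({v0,v1},t1), ..., ({v_(d-1),vd},td) is the sequence
   [:: (v1,t1); ...; (vd,td)] started at (v0,0), which forces 0 < t1. The empty
   walk, with arrival time 0, accounts for td(v,v) = 0. *)
Definition tstep (a b : 'Z_n * nat) : bool :=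
  (a.2 < b.2) && ([set a.1; b.1] \in C b.2).

Definition twalk u v t (p : seq ('Z_n * nat)) : Prop :=
  path tstep (u, 0) p /\ last (u, 0) p = (v, t).

Lemma cedges_eventually :
  exists s, forall t, s <= t -> forall i : 'Z_n, cedge i \in C t.
Proof.
have [s s0 sE] := tcycle_stable C; exists s => t st i.
have [r /andP[r0 ir]] := appearsP i.
have mono d : cedge i \in C (r + d).
  elim: d => [|d IHd]; first by rewrite addn0.
  rewrite addnS; apply: (subsetP (tcycle_mono _ _)) IHd.
  by rewrite addn_gt0 r0.
by rewrite (sE t st) -(sE (r + s)) ?leq_addl // mono.
Qed.

Lemma reachable u v : exists t, `[< exists p, twalk u v t p >].
Proof.
have [s sE] := cedges_eventually.
have walk k : exists t p, twalk u (u + k%:R)%R t p.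
  elim: k => [|k [t [p [pP pl]]]].
    by exists 0, [::]; split=> //=; rewrite addr0.
  exists (maxn s t.+1), (rcons p ((u + k.+1%:R)%R, maxn s t.+1)).
  split; last by rewrite last_rcons.
  rewrite rcons_path pP pl /tstep /= leq_maxr /= -natr1 addrA.
  exact: sE (leq_maxl _ _) _.
have [t [p pP]] := walk (v - u)%R.
exists t; apply/asboolP; exists p.
by move: pP; rewrite natr_Zp addrC subrK.
Qed.

Definition td u v : nat := ex_minn (reachable u v).

Definition Omega t v : {set 'Z_n} := [set w | td v w <= t].

Definition payoff (p q : 'Z_n) : nat := #|[set v | td p v < td q v]|.

Definition best_response w v : Prop := forall w', payoff w' v <= payoff w v.

Definition nash (p1 p2 : 'Z_n) : Prop :=
  best_response p1 p2 /\ best_response p2 p1.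

(* The edge tested is {v - k - 1, v - k}, indexed by its first endpoint. *)
Fixpoint omega_lt t v : nat :=
  if t is s.+1 then
    let k := omega_lt s v in
    if t < tau (v - k%:R - 1)%R then k else k.+1
  else 0.

Fixpoint omega_gt t v : nat :=
  if t is s.+1 then
    let k := omega_gt s v in
    if t < tau (v + k%:R)%R then k else k.+1
  else 0.

Definition omega t v : nat := 1 + omega_lt t v + omega_gt t v.

Definition comparable t v w : bool :=
  (Omega t v \subset Omega t w) || (Omega t w \subset Omega t v).

Lemma comparable_eventually v w : exists t, comparable t v w.
Proof.
exists (\max_u td w u); apply/orP; left; apply/subsetP => u _.
by rewrite inE; apply: leq_bigmax.
Qed.

Definition tbar v w : nat := ex_minn (comparable_eventually v w).

(* Colexicographic comparison of the sequences (a^i), (b^i) for i >= m. *)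
Definition colex_gt (m : nat) (a b : nat -> nat) : Prop :=
  exists2 i, m <= i & b i < a i /\ forall j, i < j -> b j <= a j.

Definition vsucc v w : Prop :=
  colex_gt (tbar v w) (omega^~ v) (omega^~ w).

Definition vsim v w : Prop :=
  forall t, tbar v w <= t -> omega t v = omega t w.

Definition vsucceq v w : Prop := vsucc v w \/ vsim v w.

Definition paramount v : Prop := forall w, w != v -> vsucceq v w.

Definition paramount_response w v : Prop :=
  best_response w v /\
  forall w', w' != w -> best_response w' v -> vsucceq w w'.

End TemporalCycle.

(* Main.v *)
From Stdlib Require Import ZArith Lia.
Require Import Defs.
From mathcomp Require Import all_boot all_order all_algebra.
From mathcomp Require Import boolp.

(** Lift the vertices to [Z], with [n]-periodic edge times. From [v] a right
front and a left front start; they reach [u] at times [R v u] ([right_time])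
and [L v u] ([left_time]). Two right fronts never overtake each other but may merge: for
[v <= w <= u], [R v u = max (R v w + (u - w)) (R w u)]. In the arc between two
players [v < w], the right front of [v] and the left front of [w] meet, after
which neither ever waits; hence the numbers of vertices of the arc first
reached by [v] and by [w] differ by exactly [L w v - R v w], and at most one
vertex is tied. So, as long as no front of one player merges with the parallel
front of the other, twice each payoff is [n], minus the number of ties (at most
[2]), plus or minus the difference of the turn times, where the turn time of
[v] is [R v (v + n) + L (v + n) v]. For large [t], [omega t v] is [2 t] plus a
constant minus this turn time, so a paramount vertex minimizes it.

If [x] is not a best response to [y], then [z] does better. Comparing the sets
of vertices won, one excludes every merging of fronts that would spoil the
payoff formula for [(x, y)] and [(z, y)]; the formula then leaves no room but
for two ties between [x] and [y] and none between [z] and [y], with payoffs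
[(n - 2) / 2] for [x] and [y] and [n / 2] for [y] and [z]. A response [w] to
[z] better than [y] would have to merge with [z] on both sides and dominate it;
then [w] does against [y] at least as well as [z], contradicting the choice of
[z] as a paramount response. *)

Local Open Scope Z_scope.

(** * Right and left fronts on the lifted line *)

Lemma Zle_ind (v : Z) (Q : Z -> Prop) :
  Q v -> (forall u, v <= u -> Q u -> Q (u + 1)) -> forall u, v <= u -> Q u.
Proof.
move=> Q0 QS u vu; rewrite -(Zplus_minus v u) -(Z2Nat.id (u - v)); last lia.
elim: (Z.to_nat (u - v)) => [|k IHk]; first by rewrite Z.add_0_r.
by rewrite Nat2Z.inj_succ -Z.add_1_r Z.add_assoc; apply: QS => //; lia.
Qed.

Fixpoint right_arrival (tau : Z -> Z) (v : Z) (k : nat) : Z :=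
  if k is S k' then
    Z.max (right_arrival tau v k' + 1) (tau (v + Z.of_nat k'))
  else 0.

Definition right_time tau v u := right_arrival tau v (Z.to_nat (u - v)).

(* Edge [i] joins [i] and [i + 1], so [u |-> - u] maps it to edge [- i - 1]. *)
Definition mirror (tau : Z -> Z) (i : Z) := tau (- i - 1).

Definition left_time tau v u := right_time (mirror tau) (- v) (- u).

Section RightFront.
Variable tau : Z -> Z.
Local Notation R := (right_time tau).

Lemma right_time_refl v : R v v = 0.
Proof. by rewrite /right_time Z.sub_diag. Qed.

Lemma right_timeS v u : v <= u -> R v (u + 1) = Z.max (R v u + 1) (tau u).
Proof.
move=> vu; rewrite /right_time.
have ->: Z.to_nat (u + 1 - v) = S (Z.to_nat (u - v)) by lia.
by rewrite [LHS]/=; congr (Z.max _ (tau _)); lia.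
Qed.

Lemma right_time_step v u u' : v <= u -> u <= u' -> R v u + (u' - u) <= R v u'.
Proof.
move=> vu; move: u'; apply: Zle_ind; first lia.
by move=> u' uu' IH; have := right_timeS v u'; lia.
Qed.

Lemma right_time_ge v u : v <= u -> u - v <= R v u.
Proof. by move=> vu; have := right_time_step v v u; rewrite right_time_refl; lia. Qed.

Lemma right_time_tau v i u : v <= i -> i < u -> tau i + (u - 1 - i) <= R v u.
Proof.
move=> vi iu; have := right_timeS v i vi.
by have := right_time_step v (i + 1) u; lia.
Qed.

(** The recursion is max-plus linear: [R v u] is the maximum of [u - v] and of all
    [tau i + (u - 1 - i)] with [v <= i < u]. Cutting the range of [i] at [w] gives the two terms. *)
Lemma right_time_split v w u :
  v <= w -> w <= u -> R v u = Z.max (R v w + (u - w)) (R w u).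
Proof.
move=> vw; move: u; apply: Zle_ind.
  by have := right_time_ge v w vw; rewrite right_time_refl; lia.
by move=> u wu; have := right_timeS v u; have := right_timeS w u; lia.
Qed.

Lemma right_time_anti v w u : v <= w -> w <= u -> R w u <= R v u.
Proof. by move=> vw wu; have := right_time_split v w u; lia. Qed.

Lemma right_time_merged v w u u' :
  v <= w -> w <= u -> u <= u' -> R v u = R w u -> R v u' = R w u'.
Proof.
move=> vw wu uu' E.
by have := right_time_split v u u'; have := right_time_split w u u'; lia.
Qed.

Lemma right_time_apart v w u u' :
  v <= w -> w <= u -> u <= u' -> R w u' < R v u' -> R w u < R v u.
Proof.
move=> vw wu uu' lt; have := right_time_anti v w u vw wu.
by have := right_time_merged v w u u'; lia.
Qed.

(** [e] is the first point where the fronts agree. Fronts that differ before an edge can leave it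
    together only if both have to wait for it. *)
Lemma right_time_merge v w m : v < w -> w <= m -> R v m = R w m ->
  exists e, [/\ w < e <= m, R v e = tau (e - 1), R w e = tau (e - 1)
             & R w (e - 1) < R v (e - 1) < tau (e - 1)].
Proof.
move=> vw; move: m; apply: Zle_ind.
  by have := right_time_ge v w; rewrite right_time_refl; lia.
move=> u wu IH E.
case: (Z.eq_dec (R v u) (R w u)) => [/IH [e [? ? ? ?]]|ne].
  by exists e; split=> //; lia.
exists (u + 1); rewrite Z.add_simpl_r; move: E.
have := right_time_anti v w u; have := right_timeS v u; have := right_timeS w u.
by split; lia.
Qed.

Lemma right_time_shift n (per : forall i, tau (i + n) = tau i) v u :
  v <= u -> R (v + n) (u + n) = R v u.
Proof.
move: u; apply: Zle_ind; first by rewrite !right_time_refl.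
move=> u vu IH; rewrite [R v _]right_timeS //.
have ->: u + 1 + n = u + n + 1 by lia.
by rewrite right_timeS ?IH ?per //; lia.
Qed.

End RightFront.

Lemma right_time_ext tau tau' v u :
  tau =1 tau' -> right_time tau v u = right_time tau' v u.
Proof.
move=> E; rewrite /right_time; elim: (Z.to_nat (u - v)) => //= k ->.
by rewrite E.
Qed.

Lemma mirrorK tau : mirror (mirror tau) =1 tau.
Proof. by move=> i; rewrite /mirror; congr tau; lia. Qed.

Lemma left_time_mirror tau v u :
  left_time (mirror tau) v u = right_time tau (- v) (- u).
Proof. exact/right_time_ext/mirrorK. Qed.

Section LeftFront.
Variable tau : Z -> Z.
Local Notation R := (right_time tau).
Local Notation L := (left_time tau).

Lemma left_time_refl v : L v v = 0.
Proof. exact: right_time_refl. Qed.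

Lemma left_timeS v u : u <= v -> L v (u - 1) = Z.max (L v u + 1) (tau (u - 1)).
Proof.
move=> uv; rewrite /left_time; have ->: - (u - 1) = - u + 1 by lia.
by rewrite right_timeS; [rewrite /mirror; do 2 f_equal; lia | lia].
Qed.

Lemma left_time_step v u u' : u <= v -> u' <= u -> L v u + (u - u') <= L v u'.
Proof.
by move=> uv u'u; have := right_time_step (mirror tau) (- v) (- u) (- u');
   rewrite /left_time; lia.
Qed.

Lemma left_time_ge v u : u <= v -> v - u <= L v u.
Proof.
by move=> uv; have := right_time_ge (mirror tau) (- v) (- u); rewrite /left_time; lia.
Qed.

Lemma left_time_tau v i u : i < v -> u <= i -> tau i + (i - u) <= L v u.
Proof.
move=> iv ui; have := right_time_tau (mirror tau) (- v) (- i - 1) (- u).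
rewrite /left_time {1}/mirror; have ->: - (- i - 1) - 1 = i by lia.
lia.
Qed.

Lemma left_time_split v w u :
  w <= v -> u <= w -> L v u = Z.max (L v w + (w - u)) (L w u).
Proof.
move=> wv uw; rewrite /left_time.
by have := right_time_split (mirror tau) (- v) (- w) (- u); lia.
Qed.

Lemma left_time_anti v w u : w <= v -> u <= w -> L w u <= L v u.
Proof. by move=> wv uw; have := left_time_split v w u; lia. Qed.

Lemma left_time_merged v w u u' :
  w <= v -> u <= w -> u' <= u -> L v u = L w u -> L v u' = L w u'.
Proof.
move=> wv uw u'u E.
by have := left_time_split v u u'; have := left_time_split w u u'; lia.
Qed.

Lemma left_time_apart v w u u' :
  w <= v -> u <= w -> u' <= u -> L w u' < L v u' -> L w u < L v u.
Proof.
move=> vw wu uu' lt; have := left_time_anti v w u vw wu.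
by have := left_time_merged v w u u'; lia.
Qed.

Lemma left_time_merge v w m : w < v -> m <= w -> L v m = L w m ->
  exists s, [/\ m <= s < w, L v s = tau s, L w s = tau s
             & L w (s + 1) < L v (s + 1) < tau s].
Proof.
move=> wv mw E.
have [||//|e] := right_time_merge (mirror tau) (- v) (- w) (- m); try lia.
rewrite /mirror; have ->: - (e - 1) - 1 = - e by lia.
move=> [? E1 E2 ?]; exists (- e); rewrite /left_time Z.opp_involutive.
have ->: - (- e + 1) = e - 1 by lia.
by split=> //; lia.
Qed.

Lemma left_time_shift n (per : forall i, tau (i + n) = tau i) v u :
  u <= v -> L (v + n) (u + n) = L v u.
Proof.
move=> uv; rewrite /left_time.
have per' i : mirror tau (i + n) = mirror tau i.
  by rewrite /mirror -[LHS]per; congr tau; lia.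
rewrite -(right_time_shift _ n per' (- (v + n))); last lia.
by congr right_time; lia.
Qed.

(* After the two fronts meet, each runs over edges the other has already
   crossed, hence never waits. *)
Lemma right_time_free v w u u' : v <= u -> u <= u' <= w ->
  L w u <= R v u -> R v u' = R v u + (u' - u).
Proof.
move=> vu [uu' u'w] le; move: u' uu' u'w; apply: (Zle_ind u); first by lia.
move=> u' uu' IH u'w; rewrite right_timeS; last lia.
by have := left_time_tau w u' u; lia.
Qed.

End LeftFront.

Lemma left_time_free tau v w u u' : u <= w -> v <= u' <= u ->
  right_time tau v u <= left_time tau w u ->
  left_time tau w u' = left_time tau w u + (u - u').
Proof.
move=> uw u'u le.
have := right_time_free (mirror tau) (- w) (- v) (- u) (- u').
rewrite left_time_mirror !Z.opp_involutive -!/(left_time _ _ _).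
lia.
Qed.

(** * Counting over half-open integer intervals *)

Fixpoint zcount_from (f : Z -> bool) (a : Z) (k : nat) : Z :=
  if k is S k' then (if f a then 1 else 0) + zcount_from f (a + 1) k' else 0.

Definition zcount f a b := zcount_from f a (Z.to_nat (b - a)).

Lemma zcount_nil f a : zcount f a a = 0.
Proof. by rewrite /zcount Z.sub_diag. Qed.

Lemma zcount_cons f a b : a < b ->
  zcount f a b = (if f a then 1 else 0) + zcount f (a + 1) b.
Proof.
move=> ab; rewrite /zcount.
by have ->: Z.to_nat (b - a) = S (Z.to_nat (b - (a + 1))) by lia.
Qed.

Lemma zcount_true (f : Z -> bool) a b : a < b -> f a -> zcount f a b = 1 + zcount f (a + 1) b.
Proof. by move=> ab fa; rewrite zcount_cons ?fa. Qed.

Lemma zcount_false (f : Z -> bool) a b : a < b -> f a = false ->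
  zcount f a b = zcount f (a + 1) b.
Proof. by move=> ab fa; rewrite zcount_cons ?fa. Qed.

Lemma Zge_ind (b : Z) (Q : Z -> Prop) :
  Q b -> (forall a, a < b -> Q (a + 1) -> Q a) -> forall a, a <= b -> Q a.
Proof.
move=> Q0 QS a ab; rewrite -(Z.opp_involutive a).
apply: (Zle_ind (- b) (fun u => Q (- u))); last lia.
  by rewrite Z.opp_involutive.
move=> u bu IH; apply: QS; first lia.
by have ->: - (u + 1) + 1 = - u by lia.
Qed.

Lemma zcount_split f a b c : a <= b -> b <= c ->
  zcount f a c = zcount f a b + zcount f b c.
Proof.
move=> ab bc; move: a ab; apply: Zge_ind; first by rewrite zcount_nil.
move=> a ab IH; rewrite [LHS]zcount_cons ?[zcount f a b]zcount_cons; lia.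
Qed.

Lemma zcount_le (f g : Z -> bool) a b : (forall u, a <= u < b -> f u -> g u) ->
  zcount f a b <= zcount g a b.
Proof.
case: (Z_le_gt_dec a b) => [ab|?]; last first.
  by move=> _; rewrite /zcount; have ->: Z.to_nat (b - a) = O by lia.
move: a ab; apply: Zge_ind => [_|a ab IH le]; first by rewrite !zcount_nil; lia.
rewrite (zcount_cons f) // (zcount_cons g) //; have := IH (fun u h => le u ltac:(lia)).
have := le a ltac:(lia); by case: (f a) => [/(_ isT) ->|_]; [|case: (g a)]; lia.
Qed.

Lemma zcount_eq f g a b : (forall u, a <= u < b -> f u = g u) ->
  zcount f a b = zcount g a b.
Proof.
by move=> E; apply: Z.le_antisymm; apply: zcount_le => u /E ->.
Qed.

Lemma zcount_const (c : bool) a b : a <= b ->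
  zcount (fun=> c) a b = if c then b - a else 0.
Proof.
move: a; apply: Zge_ind; first by rewrite zcount_nil; case: c; lia.
by move=> a ab IH; rewrite zcount_cons // IH; case: c {IH}; lia.
Qed.

Lemma zcount_all (f : Z -> bool) a b : a <= b -> (forall u, a <= u < b -> f u) ->
  zcount f a b = b - a.
Proof.
by move=> ab h; rewrite (zcount_eq _ (fun=> true)) ?zcount_const // => u /h ->.
Qed.

Lemma zcount_none (f : Z -> bool) a b : a <= b -> (forall u, a <= u < b -> ~ f u) ->
  zcount f a b = 0.
Proof.
move=> ab h; rewrite (zcount_eq _ (fun=> false)) ?zcount_const // => u /h.
by case: (f u).
Qed.

Lemma zcount_negb f a b : a <= b ->
  zcount f a b + zcount (fun u => ~~ f u) a b = b - a.
Proof.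
move: a; apply: Zge_ind; first by rewrite !zcount_nil; lia.
move=> a ab IH; rewrite zcount_cons // (zcount_cons (fun u => ~~ f u)) //=.
have ->: (if ~~ f a then 1 else 0) = 1 - (if f a then 1 else 0) by case: (f a).
by case: (f a); lia.
Qed.

Lemma zcount_shift f n a b : a <= b ->
  zcount f (a + n) (b + n) = zcount (fun u => f (u + n)) a b.
Proof.
move: a; apply: Zge_ind; first by rewrite !zcount_nil.
move=> a ab IH; rewrite zcount_cons ?[RHS]zcount_cons; try lia.
by rewrite -IH; have ->: a + n + 1 = a + 1 + n by lia.
Qed.

(** Negation turns [[a, b)] into [(-b, -a]], hence the shift by one in the bounds. *)
Lemma zcount_opp f a b : a <= b ->
  zcount (fun u => f (- u)) a b = zcount f (1 - b) (1 - a).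
Proof.
move: a; apply: Zge_ind; first by rewrite !zcount_nil.
move=> a ab IH; rewrite zcount_cons // IH.
rewrite (zcount_split f (1 - b) (1 - (a + 1)) (1 - a)); try lia.
rewrite (zcount_cons f (1 - (a + 1))); last lia.
have ->: 1 - (a + 1) + 1 = 1 - a by lia.
have ->: 1 - (a + 1) = - a by lia.
by rewrite zcount_nil; case: (f _); lia.
Qed.

(** * The arc between two players *)

Section Arc.
Variable tau : Z -> Z.
Local Notation R := (right_time tau).
Local Notation L := (left_time tau).

(** Along the arc [R v] increases and [L w] decreases, so they cross once, with at most one tie. The
    last equation holds because neither front waits after the crossing. *)
Lemma arc_meeting v w : v < w -> exists l r,
  [/\ v <= l < r /\ r <= w /\ r <= l + 2,
      forall u, v <= u <= l -> R v u < L w u,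
      forall u, r <= u <= w -> L w u < R v u,
      forall u, l < u < r -> R v u = L w u
    & L w v - R v w = l + r - v - w].
Proof.
move=> vw.
have [l [vlw h1 h2]] : exists l, [/\ v <= l < w, R v l < L w l
                                   & L w (l + 1) <= R v (l + 1)].
  have H m : v <= m -> m <= w -> R v m < L w m \/
      exists l, [/\ v <= l < w, R v l < L w l & L w (l + 1) <= R v (l + 1)].
    move: m; apply: Zle_ind => [_|m vm IH mw].
      by left; rewrite right_time_refl; have := left_time_ge tau w v; lia.
    have [|h|] := IH; [lia| |by right].
    by case: (Z_lt_le_dec (R v (m + 1)) (L w (m + 1))) => ?;
      [left|right; exists m; split; lia].
  have [||/[dup]|//] := H w; try lia.
  by rewrite left_time_refl; have := right_time_ge tau v w; lia.
have below u : v <= u <= l -> R v u < L w u.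
  by have := right_time_step tau v u l; have := left_time_step tau w l u; lia.
have SR := right_timeS tau v l ltac:(lia).
have := left_timeS tau w (l + 1); rewrite Z.add_simpl_r => SL.
have free1 := right_time_free tau v w (l + 1) w.
case: (Z.eq_dec (L w (l + 1)) (R v (l + 1))) => [E|ne].
  have lw: l + 1 < w.
    case: (Z.eq_dec (l + 1) w) E => [->|]; last lia.
    by rewrite left_time_refl; have := right_time_ge tau v w; lia.
  exists l, (l + 2); split=> //; first lia.
  - move=> u hu; have := right_time_step tau v (l + 1) u.
    by have := left_time_step tau w u (l + 1); lia.
  - by move=> u hu; have ->: u = l + 1 by lia.
  - by have := left_time_free tau v w (l + 1) v; lia.
(* Without a tie the fronts traverse edge [l] in opposite directions at the same time:
   [L w l = R v (l + 1)]. *)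
exists l, (l + 1); split=> //; first lia.
- move=> u hu; have := right_time_step tau v (l + 1) u.
  by have := left_time_step tau w u (l + 1); lia.
- by move=> u; lia.
- by have := left_time_free tau v w l v; lia.
Qed.

(** Each of the two ranges contains the player's own vertex and leaves out the opponent's, which is
    never won. *)
Definition right_share v w := zcount (fun u => R v u <? L w u) v w.
Definition left_share v w := zcount (fun u => L w u <? R v u) (v + 1) (w + 1).

Lemma arc_shares v w : v < w -> exists t,
  [/\ 0 <= t <= 1, right_share v w - left_share v w = L w v - R v w
    & right_share v w + left_share v w + t = w - v + 1].
Proof.
move=> vw; have [l [r [h1 h2 h3 h4 ->]]] := arc_meeting v w vw.
exists (r - l - 1); rewrite /right_share /left_share.
rewrite (zcount_split _ v (l + 1) w) ?(zcount_split _ (v + 1) r (w + 1)); try lia.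
rewrite (zcount_all _ v) ?(zcount_all _ r) ?(zcount_none _ (l + 1)) ?zcount_none;
  try lia; first by split; lia.
- move=> u hu /Z.ltb_lt; case: (Z_lt_le_dec l u) => hl.
    by have := h4 u; lia.
  by have := h2 u; lia.
- move=> u hu /Z.ltb_lt; case: (Z_lt_le_dec u r) => hl.
    by have := h4 u; lia.
  by have := h3 u; lia.
- by move=> u hu; apply/Z.ltb_lt/h3; lia.
- by move=> u hu; apply/Z.ltb_lt/h2; lia.
Qed.

End Arc.

(** * Arrival times and payoffs on the cycle *)

Section Game.
Variables (tau : Z -> Z) (n : Z).
Hypothesis n_gt0 : 0 < n.
Hypothesis tau_per : forall i, tau (i + n) = tau i.
Local Notation R := (right_time tau).
Local Notation L := (left_time tau).

Lemma right_time_back v u : v <= u -> R (v - n) (u - n) = R v u.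
Proof.
move=> vu; rewrite -(right_time_shift tau n tau_per (v - n)); last lia.
by rewrite !Z.sub_add.
Qed.

Lemma left_time_back v u : u <= v -> L (v - n) (u - n) = L v u.
Proof.
move=> vu; rewrite -(left_time_shift tau n tau_per (v - n)); last lia.
by rewrite !Z.sub_add.
Qed.

(* Up to periodicity [p <= u < p + n], and [u] is first reached by the right
   front of [p] or by the left front of its copy [p + n]. *)
Definition arrival p u :=
  let k := Z.modulo (u - p) n in
  Z.min (R p (p + k)) (L (p + n) (p + k)).
Local Notation T := arrival.

Lemma arrivalE p u : p <= u <= p + n -> T p u = Z.min (R p u) (L (p + n) u).
Proof.
move=> hu; rewrite /arrival.
case: (Z.eq_dec u (p + n)) => [->|ne].
  have ->: p + n - p = n by lia.
  rewrite Z_mod_same_full Z.add_0_r right_time_refl left_time_refl.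
  have := right_time_ge tau p (p + n); have := left_time_ge tau (p + n) p; lia.
by rewrite Z.mod_small; [have ->: p + (u - p) = u by lia|lia].
Qed.

Lemma arrival_shift_mul p u k : T p (u + k * n) = T p u.
Proof.
rewrite /arrival; have ->: u + k * n - p = u - p + k * n by lia.
by rewrite Z_mod_plus_full.
Qed.

Lemma residue_cases a u : exists k u0, u = u0 + k * n /\ a <= u0 < a + n.
Proof.
exists (Z.div (u - a) n), (a + Z.modulo (u - a) n).
have := Z_div_mod_eq_full (u - a) n; have := Z.mod_pos_bound (u - a) n n_gt0.
lia.
Qed.

Lemma arrival_shiftr p u : T p (u + n) = T p u.
Proof.
rewrite /arrival; have ->: u + n - p = u - p + 1 * n by lia.
by rewrite Z_mod_plus_full.
Qed.

Lemma arrival_shiftl p u : T (p + n) u = T p u.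
Proof.
rewrite /arrival; have ->: u - (p + n) = u - p + (- 1) * n by lia.
rewrite Z_mod_plus_full; set k := Z.modulo _ n.
have kn : 0 <= k < n by apply: Z.mod_pos_bound.
have ->: p + n + k = p + k + n by lia.
by rewrite right_time_shift ?left_time_shift //; lia.
Qed.

Lemma arrival_shiftl_mul p u k : T (p + k * n) u = T p u.
Proof.
have S m : T (p + (m + 1) * n) u = T (p + m * n) u.
  by rewrite -(arrival_shiftl (p + m * n)); congr T; lia.
case: (Z_le_gt_dec 0 k) => [|k0].
  by move: k; apply: Zle_ind => [|k _]; rewrite ?S // Z.add_0_r.
have {k0} : k <= 0 by lia.
by move: k; apply: Zge_ind => [|k _]; rewrite ?S // Z.add_0_r.
Qed.

Lemma arrivalEl p u : p - n <= u <= p -> T p u = Z.min (R (p - n) u) (L p u).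
Proof.
move=> hu; have {1}->: p = p - n + n by lia.
by rewrite arrival_shiftl arrivalE ?Z.sub_add //; lia.
Qed.

Lemma arrival_refl p : T p p = 0.
Proof.
rewrite arrivalE; last lia.
by rewrite right_time_refl; have := left_time_ge tau (p + n) p; lia.
Qed.

Lemma arrival_ge0 p u : 0 <= T p u.
Proof.
rewrite /arrival; have := Z.mod_pos_bound (u - p) n n_gt0.
set k := Z.modulo _ n => hk.
by have := right_time_ge tau p (p + k); have := left_time_ge tau (p + n) (p + k); lia.
Qed.

(** The left front of [p], coming from [p + n], passes [q] before entering this arc and is never
    ahead of the left front of [q]. So [p] can only win by its right front. *)
Lemma right_winP p q u : p <= u <= q -> q < p + n ->
  T p u < T q u <-> R p u < L q u /\ R p u < R (q - n) u.
Proof.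
move=> hu qp; rewrite arrivalE ?arrivalEl; try lia.
have := right_time_anti tau (q - n) p u; have := left_time_anti tau (p + n) q u.
lia.
Qed.

Lemma left_winP p q u : q <= u <= p -> p < q + n ->
  T p u < T q u <-> L p u < R q u /\ L p u < L (q + n) u.
Proof.
move=> hu qp; rewrite arrivalEl ?arrivalE; try lia.
have := right_time_anti tau (p - n) q u; have := left_time_anti tau (q + n) p u.
lia.
Qed.

Definition wins p q := zcount (fun u => T p u <? T q u) 0 n.

Lemma zcount_period f a : (forall u, f (u + n) = f u) ->
  zcount f a (a + n) = zcount f 0 n.
Proof.
move=> per; have step b : zcount f b (b + n) = zcount f (b + 1) (b + 1 + n).
  have := zcount_split f b (b + n) (b + 1 + n).
  have := zcount_split f b (b + 1) (b + 1 + n).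
  have ->: b + 1 + n = b + n + 1 by lia.
  rewrite (zcount_cons f b (b + 1)) ?(zcount_cons f (b + n)) ?per ?zcount_nil;
    try lia; case: (f b); lia.
case: (Z_le_gt_dec 0 a) => [|a0].
  by move: a; apply: Zle_ind => // a _ IH; rewrite -step.
suff: a <= 0 by move: a {a0}; apply: Zge_ind => // a _ IH; rewrite step.
lia.
Qed.

Lemma wins_window a p q : wins p q = zcount (fun u => T p u <? T q u) a (a + n).
Proof. by rewrite zcount_period // => u; rewrite !arrival_shiftr. Qed.

Lemma wins_le a p q p' q' :
  (forall u, a <= u < a + n -> T p u < T q u -> T p' u < T q' u) ->
  wins p q <= wins p' q'.
Proof.
move=> le; rewrite !(wins_window a); apply: zcount_le => u hu.
by move=> /Z.ltb_lt /(le u hu) /Z.ltb_lt.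
Qed.

Lemma wins_shiftl p q : wins (p + n) q = wins p q.
Proof. by apply: zcount_eq => u _; rewrite arrival_shiftl. Qed.

Lemma wins_shiftr p q : wins p (q + n) = wins p q.
Proof. by apply: zcount_eq => u _; rewrite arrival_shiftl. Qed.

Lemma wins_shift_mul p q k l : wins (p + k * n) (q + l * n) = wins p q.
Proof. by apply: zcount_eq => u _; rewrite !arrival_shiftl_mul. Qed.

Lemma wins_refl p : wins p p = 0.
Proof. by apply: zcount_none => [|u _ /Z.ltb_lt]; lia. Qed.

Lemma wins_sum p q : wins p q + wins q p <= n.
Proof.
have := zcount_negb (fun u => T p u <? T q u) 0 n ltac:(lia).
suff: wins q p <= zcount (fun u => ~~ (T p u <? T q u)) 0 n by rewrite /wins; lia.
by apply: zcount_le => u _ /Z.ltb_lt h; apply/negP => /Z.ltb_lt; lia.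
Qed.

(* For [v < w < v + n]: the right front of [v] catches up with that of [w],
   respectively the left front of [w] with that of [v], within a full turn. *)
Definition right_catches v w := R v (v + n) = R w (v + n).
Definition left_catches w v := L w (w - n) = L v (w - n).

Lemma right_catches_back v w :
  w <= v <= w + n -> right_catches v (w + n) <-> right_catches (v - n) w.
Proof.
move=> vw; rewrite /right_catches -(right_time_back v); last lia.
rewrite -(right_time_back (w + n)); last lia.
by rewrite !Z.add_simpl_r Z.sub_add.
Qed.

Lemma left_catches_back v w :
  v <= w <= v + n -> left_catches (v + n) w <-> left_catches v (w - n).
Proof.
move=> vw; rewrite /left_catches -(left_time_back (v + n)); last lia.
rewrite -(left_time_back w); last lia.
by rewrite !Z.add_simpl_r.
Qed.

Lemma left_catchesE v w :
  v <= w <= v + n -> left_catches w v <-> L (w + n) w = L (v + n) w.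
Proof.
move=> vw; have := left_time_back (w + n) w; have := left_time_back (v + n) w.
by rewrite /left_catches !Z.add_simpl_r; lia.
Qed.

Lemma right_uncaught v w u : v < w -> w <= u <= v + n ->
  ~ right_catches v w -> R w u < R v u.
Proof.
move=> vw hu nc; have := right_time_anti tau v w u.
case: (Z.eq_dec (R v u) (R w u)) => [E|]; last lia.
by case: nc; apply: (right_time_merged tau v w u); lia.
Qed.

Lemma left_uncaught v w u : v < w -> w - n <= u <= v ->
  ~ left_catches w v -> L v u < L w u.
Proof.
move=> vw hu nc; have := left_time_anti tau w v u.
case: (Z.eq_dec (L w u) (L v u)) => [E|]; last lia.
by case: nc; apply: (left_time_merged tau w v u); lia.
Qed.

(** The second arc counts [v + n], the same vertex as [v], hence the [- 1]. The shares overcount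
    only where the right front of [w - n] or the left front of [w + n], coming from behind [v],
    catches the parallel front of [v]. *)
Lemma wins_le_shares v w : v < w < v + n ->
  wins v w <= right_share tau v w + left_share tau w (v + n) - 1 /\
  (~ right_catches w (v + n) -> ~ left_catches w v ->
   wins v w = right_share tau v w + left_share tau w (v + n) - 1).
Proof.
move=> vw; pose f u := T v u <? T w u.
have ->: wins v w = zcount f v w + zcount f (w + 1) (v + n).
  rewrite (wins_window v) (zcount_split _ v w (v + n)); try lia.
  rewrite (zcount_false _ w) //; first lia.
  by apply/Z.ltb_ge; rewrite arrival_refl; apply: arrival_ge0.
have ->: left_share tau w (v + n) =
         zcount (fun u => L (v + n) u <? R w u) (w + 1) (v + n) + 1.
  rewrite /left_share (zcount_split _ (w + 1) (v + n) (v + n + 1)); try lia.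
  rewrite (zcount_true _ (v + n)) ?zcount_nil //; try lia.
  by apply/Z.ltb_lt; rewrite left_time_refl; have := right_time_ge tau w (v + n); lia.
rewrite /right_share; split=> [|nc1 nc2].
  set A := zcount f v w; set B := zcount f (w + 1) _.
  set A' := zcount _ v w; set B' := zcount _ (w + 1) (v + n).
  suff: A <= A' /\ B <= B' by lia.
  split; apply: zcount_le => u hu /Z.ltb_lt; rewrite /f => h; apply/Z.ltb_lt.
    by apply (right_winP v w u); lia.
  by apply (left_winP (v + n) w u); rewrite ?arrival_shiftl; lia.
rewrite (zcount_eq f (fun u => R v u <? L w u)); last first.
  move=> u hu; apply/idP/idP => /Z.ltb_lt h; apply/Z.ltb_lt.
    by apply (right_winP v w u); lia.
  apply/(right_winP v w u); try lia; split=> //.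
  apply: right_uncaught; try lia.
  by rewrite -right_catches_back //; lia.
rewrite (zcount_eq f (fun u => L (v + n) u <? R w u) (w + 1)) //; first lia.
move=> u hu; apply/idP/idP => /Z.ltb_lt h; apply/Z.ltb_lt.
  by apply (left_winP (v + n) w u); rewrite ?arrival_shiftl //; lia.
suff: T (v + n) u < T w u by rewrite arrival_shiftl.
apply/(left_winP (v + n) w u); try lia; split=> //.
apply: left_uncaught; try lia.
by rewrite left_catches_back ?Z.add_simpl_r //; lia.
Qed.

(** [arc_shares] is added over both arcs, and [t] collects their ties. Without any merging, [d] is
    the turn time of [w] minus that of [v]. Mergings only cost a player wins, so the upper bounds
    need no side condition. *)
Theorem wins_formula v w : v < w < v + n -> exists t,
  let d := L w v + R w (v + n) - R v w - L (v + n) w in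
  [/\ 0 <= t <= 2, 2 * wins v w <= n - t + d, 2 * wins w v <= n - t - d,
      R w (w + n) <> R (v + n) (w + n) -> L (w + n) w <> L (v + n) w ->
      2 * wins v w = n - t + d
    & R v (v + n) <> R w (v + n) -> L (v + n) v <> L w v ->
      2 * wins w v = n - t - d].
Proof.
move=> vw.
have [c1 c1'] := left_catchesE v w ltac:(lia).
have [c2 c2'] := left_catchesE (w - n) v ltac:(lia).
have [c3 c3'] := left_catches_back v w ltac:(lia).
rewrite Z.sub_add in c2 c2'.
have [|t [t01 E1 E2]] := arc_shares tau v w; first lia.
have [|t' [t01' E1' E2']] := arc_shares tau w (v + n); first lia.
have [] := wins_le_shares v w vw.
have [|] := wins_le_shares w (v + n); first lia.
have ->: left_share tau (v + n) (w + n) = left_share tau v w.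
  rewrite /left_share.
  have ->: v + n + 1 = v + 1 + n by lia.
  have ->: w + n + 1 = w + 1 + n by lia.
  rewrite zcount_shift; last lia.
  apply: zcount_eq => u hu.
  by rewrite right_time_shift ?left_time_shift //; lia.
rewrite wins_shiftr => A B C D; exists (t + t'); split; try lia.
  by move=> nc1 nc2; have := D nc1 (fun c => nc2 (c1 c)); lia.
move=> nc1 nc2; have := B _ (fun c => nc2 (c2 (c3 c))).
rewrite right_catches_back; last lia.
rewrite Z.add_simpl_r; move/(_ nc1); lia.
Qed.


(** * Payoff comparisons forced by merging fronts of three players *)

Section ThreePoints.
Variables x y z : Z.
Hypotheses (xy : x < y) (yz : y < z) (zx : z < x + n).

(** Let the left fronts of [y + n] and [x + n] merge at edge [s]. If [s < z], then [x] wins against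
    [y] whatever [z] wins. Otherwise [z] beats [y] only on [[y, s]], where [y] is no later than [x],
    so [z] beats [x] there too. *)
Lemma wins_le_of_left_catches :
  left_catches y x -> wins z y <= wins x y \/ wins z y <= wins z x.
Proof.
rewrite left_catchesE => [E|]; last lia.
have [|||s [hs Ey Ex hs1]] := left_time_merge tau (y + n) (x + n) y; try lia.
case: (Z_lt_le_dec s z) => sz; [left; apply: (wins_le x)|right; apply: (wins_le y)].
  move=> u hu; case: (Z_le_gt_dec u y) => uy.
    rewrite (arrivalE x) ?(arrivalEl y) ?(arrivalEl z); try lia.
    have := right_time_anti tau (z - n) x u; have := left_time_anti tau z y u.
    lia.
  case: (Z_le_gt_dec u s) => us.
    rewrite (arrivalE y) ?(arrivalEl z); try lia.
    have := right_time_anti tau (z - n) y u.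
    have := left_time_merged tau (y + n) z s u.
    have := left_time_tau tau z s s.
    by have := left_time_anti tau (x + n) z s; lia.
  rewrite (arrivalE x) ?(arrivalE y); try lia.
  have := right_time_tau tau y s u.
  have := left_time_step tau (x + n) u (s + 1).
  have := left_time_apart tau (y + n) (x + n) u (s + 1).
  lia.
move=> u hu; case: (Z_le_gt_dec u s) => us.
  rewrite (arrivalE x) ?(arrivalE y); try lia.
  have := right_time_anti tau x y u.
  have := left_time_merged tau (y + n) (x + n) s u.
  lia.
rewrite (arrivalE y) ?(arrivalE z); try lia.
have := right_time_tau tau z s u.
have := left_time_step tau (y + n) u (s + 1).
have := left_time_anti tau (z + n) (y + n) u.
lia.
Qed.

(** Let [s] be the merging edge. Up to [s], the vertices that [z] wins against [y] are reached no
    later by [x]; beyond [s], the left front of [x + n] beats both fronts of [y]. *)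
Lemma wins_le_of_left_merge : ~ left_catches y x ->
  L (x + n) y = L z y -> wins z y <= wins x y.
Proof.
move=> nc E.
have [|||s [hs Ex Ez hs1]] := left_time_merge tau (x + n) z y; try lia.
apply: (wins_le x) => u hu; case: (Z_le_gt_dec u y) => uy.
  rewrite (arrivalE x) ?(arrivalEl y) ?(arrivalEl z); try lia.
  have := right_time_anti tau (z - n) x u; have := left_time_anti tau z y u.
  lia.
case: (Z_le_gt_dec u s) => us.
  rewrite (arrivalE x) ?(arrivalE y) ?(arrivalEl z); try lia.
  have := right_time_anti tau (z - n) y u.
  have := left_time_merged tau (x + n) z s u.
  lia.
rewrite (arrivalE x) ?(arrivalE y); try lia.
have lt : L (x + n) u < L (y + n) u.
  apply: left_uncaught; try lia.
  by rewrite left_catches_back ?Z.add_simpl_r //; lia.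
have := right_time_tau tau y s u.
have := left_time_step tau (x + n) u (s + 1).
lia.
Qed.

Hypothesis zy_merge : L z x = L y x.

Lemma zy_mergeE : exists s, [/\ x <= s < y, L z s = tau s, L y s = tau s
  & L y (s + 1) < L z (s + 1) < tau s].
Proof. by apply: left_time_merge; lia. Qed.

(** Up to the merging edge [s], and again from [z] on, [y] never beats [z]. On [(s, y]] the left
    front of [y] beats [x], and between [y] and [z] the left front of [z] keeps [z] no later than
    [x]. *)
Lemma wins_le_merged_opponent : wins y z <= wins y x.
Proof.
have [s [hs Ez Ey hs1]] := zy_mergeE.
apply: (wins_le x) => u hu; case: (Z_le_gt_dec u s) => us.
  rewrite (arrivalEl y) ?(arrivalEl z); try lia.
  have := right_time_anti tau (y - n) (z - n) u.
  have := left_time_merged tau z y s u.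
  lia.
have := right_time_tau tau x s u.
case: (Z_le_gt_dec u y) => uy.
  rewrite (arrivalE x) ?(arrivalEl y); try lia.
  have := left_time_step tau y u (s + 1).
  have := left_time_apart tau z y u (s + 1).
  have := left_time_anti tau (x + n) z u.
  lia.
case: (Z_lt_le_dec u z) => uz.
  rewrite (arrivalE x) ?(arrivalE y) ?(arrivalEl z); try lia.
  have := left_time_step tau z u (s + 1).
  have := left_time_anti tau (x + n) z u.
  have := left_time_anti tau (y + n) (x + n) u.
  lia.
rewrite (arrivalE y) ?(arrivalE z); try lia.
have := right_time_anti tau y z u.
have := left_time_merged tau (z + n) (y + n) (x + n) u.
rewrite !left_time_shift //; lia.
Qed.

(** Up to [s], [y] can beat [x] only by its left front, which has merged with that of [z]. On
    [(s, z]] the left front of [z] beats both fronts of [x]. Beyond [z], [y] can beat [x] only by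
    its right front, and that of [z] is no later. *)
Lemma wins_le_merged_player : L (x + n) y <> L z y -> wins y x <= wins z x.
Proof.
move=> ne; have [s [hs Ez Ey hs1]] := zy_mergeE.
have lt : L z y < L (x + n) y by have := left_time_anti tau (x + n) z y; lia.
(* A merging of [x + n] with [z] at an edge between [s] and [y] would make [y] wait there too,
   although [y] is still strictly ahead of [z]; a merging further right contradicts [lt]. *)
have apart u : s < u <= z -> L z u < L (x + n) u.
  move=> hu; case: (Z_le_gt_dec u y) => uy; last first.
    by apply: (left_time_apart tau (x + n) z u y); lia.
  have := left_time_anti tau (x + n) z u.
  case: (Z.eq_dec (L (x + n) u) (L z u)) => [E|]; last lia.
  have [|||s2 [hs2 Ex2 Ez2 _]] := left_time_merge tau (x + n) z u; try lia.
  case: (Z_lt_le_dec s2 y) => s2y.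
    have := left_time_tau tau y s2 s2.
    have := left_time_apart tau z y s2 (s + 1).
    lia.
  have := left_time_merged tau (x + n) z s2 y; lia.
apply: (wins_le x) => u hu; case: (Z_le_gt_dec u s) => us.
  rewrite (arrivalE x) ?(arrivalEl y) ?(arrivalEl z); try lia.
  have := right_time_anti tau (y - n) x u.
  have := left_time_merged tau z y s u.
  lia.
case: (Z_le_gt_dec u z) => uz.
  rewrite (arrivalE x) ?(arrivalEl z); try lia.
  have := right_time_tau tau x s u.
  have := left_time_step tau z u (s + 1).
  have := apart u.
  lia.
rewrite (arrivalE x) ?(arrivalE y) ?(arrivalE z); try lia.
have := right_time_anti tau y z u.
have := left_time_anti tau (y + n) (x + n) u.
lia.
Qed.

End ThreePoints.

(** * Turn times and the extremal configuration of three players *)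

Definition turn_time v := R v (v + n) + L (v + n) v.

(** Times over several arcs become max-plus expressions in the six single-arc times, which turns
    [three_points] into linear arithmetic with maxima. *)
Lemma three_arcs x y z : x < y -> y < z -> z < x + n ->
  [/\ [/\ R x z = Z.max (R x y + (z - y)) (R y z),
          R y (x + n) = Z.max (R y z + (x + n - z)) (R z (x + n))
        & R z (y + n) = Z.max (R z (x + n) + (y - x)) (R x y)],
      [/\ R x (x + n) = Z.max (R x z + (x + n - z)) (R z (x + n)),
          R y (y + n) = Z.max (R y (x + n) + (y - x)) (R x y)
        & R z (z + n) = Z.max (R z (y + n) + (z - y)) (R y z)],
      [/\ L z x = Z.max (L z y + (y - x)) (L y x),
          L (x + n) y = Z.max (L (x + n) z + (z - y)) (L z y)
        & L (y + n) z = Z.max (L y x + (x + n - z)) (L (x + n) z)]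
    & [/\ L (x + n) x = Z.max (L (x + n) y + (y - x)) (L y x),
          L (y + n) y = Z.max (L (y + n) z + (z - y)) (L z y)
        & L (z + n) z = Z.max (L z x + (x + n - z)) (L (x + n) z)]].
Proof.
move=> xy yz zx.
have Rxy := right_time_shift tau n tau_per x y ltac:(lia).
have Ryz := right_time_shift tau n tau_per y z ltac:(lia).
have Lyx := left_time_shift tau n tau_per y x ltac:(lia).
have Lzx := left_time_shift tau n tau_per z x ltac:(lia).
split; split.
- by have := right_time_split tau x y z; lia.
- by have := right_time_split tau y z (x + n); lia.
- by have := right_time_split tau z (x + n) (y + n); lia.
- by have := right_time_split tau x z (x + n); lia.
- by have := right_time_split tau y (x + n) (y + n); lia.
- by have := right_time_split tau z (y + n) (z + n); lia.
- by have := left_time_split tau z y x; lia.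
- by have := left_time_split tau (x + n) z y; lia.
- by have := left_time_split tau (y + n) (x + n) z; lia.
- by have := left_time_split tau (x + n) y x; lia.
- by have := left_time_split tau (y + n) z y; lia.
- by have := left_time_split tau (z + n) (x + n) z; lia.
Qed.

Lemma turn_time_shift_mul v k : turn_time (v + k * n) = turn_time v.
Proof.
have S m : turn_time (v + (m + 1) * n) = turn_time (v + m * n).
  have ->: v + (m + 1) * n = v + m * n + n by lia.
  rewrite /turn_time right_time_shift ?left_time_shift //; lia.
case: (Z_le_gt_dec 0 k) => [|k0].
  by move: k; apply: Zle_ind => [|k _]; rewrite ?S // Z.add_0_r.
have {k0} : k <= 0 by lia.
by move: k; apply: Zge_ind => [|k _]; rewrite ?S // Z.add_0_r.
Qed.

(** Once the mergings of left fronts that would spoil the formulas are excluded, the payoff formulas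
    for the three pairs fit the inequalities with no slack, which forces every equality. *)
Theorem three_points x y z : x < y -> y < z -> z < x + n ->
  turn_time x <= turn_time y -> turn_time x <= turn_time z ->
  wins y x <= wins x y -> wins z x <= wins y x -> wins x y < wins z y ->
  (wins z x = wins y x -> wins z y <= wins y z) ->
  [/\ 2 * wins y x = n - 2, 2 * wins z y = n, 2 * wins y z = n,
      turn_time z = turn_time x
    & [/\ R y (y + n) <> R z (y + n), R z (z + n) <> R (y + n) (z + n),
          L (y + n) y <> L z y & L (z + n) z <> L (y + n) z]].
Proof.
move=> xy yz zx Fxy Fxz Wxy Wzx Wzy Wtie.
have ncyx : ~ left_catches y x.
  by move=> c; have := wins_le_of_left_catches x y z xy yz zx c; lia.
have nE : L (x + n) y <> L z y.
  by move=> E; have := wins_le_of_left_merge x y z xy yz zx ncyx E; lia.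
have nD : L z x <> L y x.
  move=> E; have := wins_le_merged_opponent x y z xy yz zx E.
  have := wins_le_merged_player x y z xy yz zx E nE; lia.
have [|t1 [ht1 _ hyx1 hxy _]] := wins_formula x y; first lia.
have [|t2 [ht2 hyz1 hzy1 hyz _]] := wins_formula y z; first lia.
have [|t3 [ht3 _ hzx1 _ hzx]] := wins_formula x z; first lia.
move: ncyx Fxy Fxz; rewrite left_catchesE /turn_time; last lia.
have [] := three_arcs x y z xy yz zx.
have := left_time_shift tau n tau_per z x ltac:(lia).
have := right_time_shift tau n tau_per x y ltac:(lia).
have := right_time_shift tau n tau_per y z ltac:(lia).
have := right_time_ge tau x y ltac:(lia).
have := right_time_ge tau y z ltac:(lia).
have := right_time_ge tau z (x + n) ltac:(lia).
have := left_time_ge tau y x ltac:(lia).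
have := left_time_ge tau z y ltac:(lia).
have := left_time_ge tau (x + n) z ltac:(lia).
move: hyx1 hzy1 hzx1 hyz1 hxy hyz hzx nE nD.
(* [a], [b], [c] name the right times over the three arcs from [x] to [y], to [z], to [x + n];
   concatenations are times over consecutive arcs, a prefix [l] marks left times, a prime a copy
   shifted by [n]. *)
move: (R x y) (R y z) (R z (x + n)) (R x z) (R y (x + n)) (R z (y + n))
  (R x (x + n)) (R y (y + n)) (R z (z + n)) (R (x + n) (y + n)) (R (y + n) (z + n))
  (L y x) (L z y) (L (x + n) z) (L z x) (L (x + n) y) (L (y + n) z)
  (L (x + n) x) (L (y + n) y) (L (z + n) z) (L (z + n) (x + n))
  (wins x y) (wins y x) (wins y z) (wins z y) (wins z x) Wxy Wzx Wzy Wtie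
  => a b c ab bc ca abc bca cab a' b' la lb lc lab lbc lca labc lbca lcab lab'
  Wxy Wyx Wyz Wzy Wzx W1 W2 W3 _.
move=> hyx1 hzy1 hzx1 hyz1 hxy hyz hzx nE nD g1 g2 g3 g4 g5 g6 Eb Ea _; subst a' b'.
move=> [Eab Ebc Eca] [Eabc Ebca Ecab] [ELab ELbc ELca] [ELabc ELbca ELcab].
move=> ny Fy Fz.
have lE : lc + (z - y) > lb by clear - ELbc nE; lia.
have lD : lb + (y - x) > la by clear - ELab nD; lia.
have {ELab ELbc} [ELab ELbc] : lab = lb + (y - x) /\ lbc = lc + (z - y).
  by clear - ELab ELbc lE lD; lia.
have {}ELabc : labc = lc + (z - x) by clear - ELabc ELbc lE lD; lia.
have lC : la + (x + n - z) > lc by clear - ELbca ELca ELbc lE ny; lia.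
have {}ELca : lca = la + (x + n - z) by clear - ELca lC; lia.
have {}ELcab : lcab = lb + (y + n - z) by clear - ELcab ELab lC lD; lia.
have {}ELbca : lbca = Z.max (la + (x + n - y)) lb by clear - ELbca ELca; lia.
(* If the right front of [y] caught that of [x + n], the turn time of [y] would be below that of
   [x]. *)
have ncR : bca <> a.
  by clear - Eab Ebc Eabc Ebca ELabc ELbca Fy lD lE lC xy yz zx; lia.
have {}hxy := hxy ncR ny.
have rgap : b - ca - bc + a <= abc - cab - 2 * (x + n - z).
  by clear - Eab Ebc Eca Eabc Ecab xy yz zx; lia.
(* By [rgap] the differences [d] of the pairs [x y] and [y z] add up to at least the turn time of
   [z] minus that of [x], which is nonnegative. Doubled, [wins x y < wins z y] is a gap of at least
   2, and only [t1 - t2 = 2] allows it. *)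
have [Et1 Et2 Ed EF] : [/\ t1 = 2, t2 = 0, la + bc - a - lbc = - (lb + ca - b - lca)
                 & cab + lcab = abc + labc].
  clear - hxy hzy1 ht1 ht2 W3 rgap ELca ELbc ELabc ELcab Fz; split; lia.
have ncX : abc <> c.
  by clear - Ecab Eca Eabc Eab Ebc EF ELabc ELcab lD lE lC xy yz zx; lia.
have {}hzx := hzx ncX ltac:(clear - ELabc ELab lE; lia).
have xgap : c - ab <= cab - abc + 2 * (x + n - z) - n.
  by clear - ncX Ecab Eca Eabc Eab Ebc xy yz zx; lia.
(* By [xgap] and [EF] the [d] of [x z] is at most 0, so [n - 2 <= 2 * wins z x <= 2 * wins y x]. The
   latter is at most [n - 2 - d] by the formula and [n - 2 + d] by comparison with [wins x y], for
   the [d] of [x y]. *)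
have Ed0 : la + bc - a - lbc = 0.
  clear - Et1 hxy hyx1 hzx ht3 xgap EF W1 W2 ELab ELabc ELcab.
  lia.
have bca_ca : bca <> ca.
  by clear - Ebca Ebc Eca Ed Ed0 ELca lD ncR xy yz zx; lia.
have cab_b : cab <> b.
  by clear - Ecab Ed Ed0 ELca lE lC xy yz zx; lia.
have lcab_lca : lcab <> lca by clear - ELcab ELca lD; lia.
have lbca_lb : lbca <> lb by clear - ELbca lE lC; lia.
have {}hyz := hyz cab_b lcab_lca.
split; [| | | |split=> //]; clear - hxy hyx1 hzx hzy1 hyz W1 W2 W3 Ed Ed0 Et1 Et2
  ht3 EF xgap ELab ELabc ELcab; try lia.
Qed.

(* Neither front of [v] or [w] ever merges with the parallel front of the other. *)
Definition uncaught v w :=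
  [/\ R v (v + n) <> R w (v + n), R w (w + n) <> R (v + n) (w + n),
      L (v + n) v <> L w v & L (w + n) w <> L (v + n) w].

Lemma uncaught_shift v w : v < w < v + n -> uncaught v w -> uncaught w (v + n).
Proof.
move=> vw [h1 h2 h3 h4]; split=> //.
  by rewrite !right_time_shift //; lia.
by rewrite !left_time_shift //; lia.
Qed.

Lemma two_arcs v w : v < w < v + n ->
  [/\ R v (v + n) = Z.max (R v w + (v + n - w)) (R w (v + n)),
      R w (w + n) = Z.max (R w (v + n) + (w - v)) (R v w),
      L (v + n) v = Z.max (L (v + n) w + (w - v)) (L w v)
    & L (w + n) w = Z.max (L w v + (v + n - w)) (L (v + n) w)].
Proof.
move=> vw.
have Rvw := right_time_shift tau n tau_per v w ltac:(lia).
have Lwv := left_time_shift tau n tau_per w v ltac:(lia).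
split.
- by have := right_time_split tau v w (v + n); lia.
- by have := right_time_split tau w (v + n) (w + n); lia.
- by have := left_time_split tau (v + n) w v; lia.
- by have := left_time_split tau (w + n) (v + n) w; lia.
Qed.

(** Winning more than half without a smaller turn time requires mergings on both sides. Then [w] and
    [z] arrive simultaneously on a segment around [y], and outside it [w] beats [y] everywhere. *)
Lemma wins_le_dominating w z y : w < z -> z < y -> y < w + n ->
  uncaught z y -> turn_time z <= turn_time w -> n < 2 * wins w z ->
  wins z y <= wins w y.
Proof.
move=> wz zy yw [u1 u2 u3 u4] F W.
have [|t [ht h1 _ _ _]] := wins_formula w z; first lia.
have [Rw Rz Lw Lz] := two_arcs w z ltac:(lia).
have Rwz := right_time_shift tau n tau_per w z ltac:(lia).
have [[Ew Ez]|[Ew Ez]] :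
    R w (w + n) = R z (w + n) /\ L (z + n) z = L (w + n) z \/
    R z (z + n) = R w z /\ L (w + n) w = L z w.
- by rewrite /turn_time in F; clear - F W ht h1 Rw Rz Lw Lz wz zy yw; lia.
- have [|||e [he E1 E2 he1]] := right_time_merge tau w z (w + n); try lia.
  have [|||s [hs E3 E4 hs1]] := left_time_merge tau (z + n) (w + n) z; try lia.
  (* Otherwise [y] would wait at edge [e - 1] as well and merge with [z], against [uncaught z y]. *)
  have ey : e <= y.
    case: (Z_le_gt_dec e y) => // ye.
    have := right_time_tau tau y (e - 1) e; have := right_time_anti tau z y e.
    have := right_time_merged tau z y e (z + n); lia.
  have ys : y <= s.
    case: (Z_le_gt_dec y s) => // sy.
    have := left_time_tau tau y s s; have := left_time_anti tau (z + n) y s.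
    have := left_time_anti tau (w + n) y s.
    have := left_time_merged tau (z + n) y s z; lia.
  apply: (wins_le w) => u hu; case: (Z_lt_le_dec u e) => ue.
    rewrite (arrivalE w) ?(arrivalEl y); try lia.
    have := right_time_step tau w u (e - 1).
    have := left_time_tau tau y (e - 1) u.
    have := right_time_merged tau (y - n) w u e.
    have := right_time_apart tau (y - n) z e y.
    have := right_time_back y (y + n); have := right_time_back (z + n) (y + n).
    rewrite !Z.add_simpl_r.
    have := right_time_anti tau (y - n) z y.
    have := right_time_anti tau (y - n) w u.
    lia.
  case: (Z_le_gt_dec u s) => us.
    rewrite (arrivalE w) ?(arrivalE z); try lia.
    have := right_time_merged tau w z e u.
    have := left_time_merged tau (z + n) (w + n) s u.
    lia.
  rewrite (arrivalE w) ?(arrivalE y); try lia.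
  have := left_time_step tau (w + n) u (s + 1).
  have := right_time_tau tau y s u.
  have := left_time_anti tau (z + n) (w + n) u.
  have := left_time_apart tau (y + n) (z + n) u y.
  have := left_time_anti tau (y + n) (z + n) y.
  lia.
(* If [z] catches [w + n] on the right, it also catches [y], which lies between them. *)
- have := right_time_anti tau z y (z + n).
  have := right_time_anti tau y (w + n) (z + n).
  lia.
Qed.

(* Here [v] catches [w] on the right at time [R v (e - 1)] and [w] catches [v]
   on the left at time [L (w + n) (s + 1)]: whoever is first wins more. *)
Lemma mutual_catch v w : v < w < v + n ->
  R v (v + n) = R w (v + n) -> L (w + n) w = L (v + n) w -> exists e s,
  [/\ w < e <= s + 1 /\ w <= s < v + n,
      R v e = R w e /\ R w (e - 1) < R v (e - 1) < tau (e - 1),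
      L (w + n) s = L (v + n) s /\ L (v + n) (s + 1) < L (w + n) (s + 1) < tau s
    & wins v w - wins w v = L (w + n) (s + 1) - R v (e - 1)].
Proof.
move=> vw Ev Ew.
have [Rv Rw Lv Lw] := two_arcs v w vw.
have [|||e [he E1 E2 he1]] := right_time_merge tau v w (v + n); try lia.
have [|||s [hs E3 E4 hs1]] := left_time_merge tau (w + n) (v + n) w; try lia.
have es : e <= s + 1.
  case: (Z_le_gt_dec e (s + 1)) => // se.
  have := left_time_tau tau (v + n) (e - 1) (s + 1).
  have := right_time_tau tau v s (e - 1).
  lia.
exists e, s; split; try lia.
have Rvw := right_time_shift tau n tau_per v w ltac:(lia).
have Lwv := left_time_shift tau n tau_per w v ltac:(lia).
have ncR u : v <= u <= w -> R v u < R (w - n) u.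
  move=> hu; apply: right_uncaught; try lia.
  rewrite -right_catches_back /right_catches; lia.
have ncL u : v <= u <= w -> L w u < L (v + n) u.
  move=> hu; have := left_time_apart tau (v + n) w u v.
  lia.
clear Rv Rw Lv Lw.
have -> : wins v w = right_share tau v w + (v + n - (s + 1)).
  rewrite (wins_window v) (zcount_split _ v w); try lia.
  rewrite (zcount_split _ w (s + 1)); try lia.
  rewrite (zcount_eq _ (fun u => R v u <? L w u) v); last first.
    move=> u hu; apply/idP/idP => /Z.ltb_lt h; apply/Z.ltb_lt.
      by apply (right_winP v w u); lia.
    by apply/(right_winP v w u); [lia|lia|split=> //; apply: ncR; lia].
  rewrite (zcount_none _ w) ?(zcount_all _ (s + 1)); try lia.
    by rewrite /right_share; lia.
  - move=> u hu; apply/Z.ltb_lt; rewrite !arrivalE; try lia.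
    have := left_time_step tau (v + n) u (s + 1).
    have := right_time_tau tau w s u.
    have := left_time_apart tau (w + n) (v + n) u (s + 1).
    lia.
  - move=> u hu /Z.ltb_lt; rewrite !arrivalE; try lia.
    have := right_time_anti tau v w u.
    have := left_time_merged tau (w + n) (v + n) s u.
    lia.
have -> : wins w v = left_share tau v w + (e - 1 - w).
  rewrite (wins_window (v + 1)) (zcount_split _ (v + 1) (w + 1)); try lia.
  rewrite (zcount_split _ (w + 1) e); try lia.
  rewrite (zcount_eq _ (fun u => L w u <? R v u) (v + 1)); last first.
    move=> u hu; apply/idP/idP => /Z.ltb_lt h; apply/Z.ltb_lt.
      by apply (left_winP w v u); lia.
    by apply/(left_winP w v u); [lia|lia|split=> //; apply: ncL; lia].
  rewrite (zcount_all _ (w + 1)) ?(zcount_none _ e); try lia.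
    by rewrite /left_share; lia.
  - move=> u hu /Z.ltb_lt; rewrite !arrivalE; try lia.
    have := left_time_anti tau (w + n) (v + n) u.
    have := right_time_merged tau v w e u.
    lia.
  - move=> u hu; apply/Z.ltb_lt; rewrite !arrivalE; try lia.
    have := right_time_step tau w u (e - 1).
    have := left_time_tau tau (v + n) (e - 1) u.
    have := right_time_apart tau v w u (e - 1).
    lia.
(* At [e - 1] and [s + 1] the fronts are still apart, so [R v (e - 1) = R v w + (e - 1 - w)], and
   likewise on the left. *)
have [|t [_ Eshare _]] := arc_shares tau v w; first lia.
have := left_time_split tau (w + n) (v + n) (s + 1).
have := right_time_split tau v w (e - 1).
lia.
Qed.

Lemma arrival_stepr p u : p <= u < p + n ->
  T p (u + 1) <= Z.max (T p u + 1) (tau u).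
Proof.
move=> hu; rewrite !arrivalE; try lia.
have := right_timeS tau p u; have := left_time_step tau (p + n) (u + 1) u.
lia.
Qed.

Lemma arrival_stepl p u : p < u <= p + n ->
  T p (u - 1) <= Z.max (T p u + 1) (tau (u - 1)).
Proof.
move=> hu; rewrite !arrivalE; try lia.
have := left_timeS tau (p + n) u; have := right_time_step tau p (u - 1) u.
lia.
Qed.

(* Past a full turn every edge has already been crossed once. *)
Lemma right_time_late v u : v + n <= u ->
  R v u = R v (v + n) + (u - (v + n)).
Proof.
move=> hu; have := right_time_split tau v (v + n) u.
have := right_time_back (v + n) u; rewrite Z.add_simpl_r.
have := right_time_step tau v (u - n) u.
lia.
Qed.

End Game.

(** * Reflection, and step counts as inverse arrival times *)

Section Mirror.
Variables (tau : Z -> Z) (n : Z).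
Hypothesis n_gt0 : 0 < n.
Hypothesis tau_per : forall i, tau (i + n) = tau i.
Local Notation R := (right_time tau).
Local Notation L := (left_time tau).
Local Notation R' := (right_time (mirror tau)).
Local Notation T := (arrival tau n).

Lemma mirror_per i : mirror tau (i + n) = mirror tau i.
Proof. by rewrite /mirror -[LHS]tau_per; congr tau; lia. Qed.

Lemma right_time_mirror v u : R' v u = L (- v) (- u).
Proof. by rewrite /left_time !Z.opp_involutive. Qed.

Lemma arrival_mirror p u : arrival (mirror tau) n (- p) (- u) = T p u.
Proof.
have [k [u0 [-> hu]]] := residue_cases n n_gt0 p u.
have ->: - (u0 + k * n) = - u0 + - k * n by lia.
rewrite !arrival_shift_mul (arrivalE tau) //; last lia.
rewrite (arrivalEl (mirror tau) n n_gt0 mirror_per); last lia.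
rewrite left_time_mirror right_time_mirror !Z.opp_involutive.
have -> : - (- p - n) = p + n by lia.
lia.
Qed.

Lemma wins_mirror p q : wins (mirror tau) n (- p) (- q) = wins tau n p q.
Proof.
rewrite [RHS](wins_window _ _ n_gt0 (1 - n)) Z.sub_add.
have := zcount_opp (fun u => T p u <? T q u) 0 n ltac:(lia).
rewrite Z.sub_0_r => <-; apply: zcount_eq => u _.
by rewrite -(arrival_mirror p) -(arrival_mirror q) Z.opp_involutive.
Qed.

Lemma turn_time_mirror v : turn_time (mirror tau) n (- v) = turn_time tau n v.
Proof.
rewrite /turn_time left_time_mirror right_time_mirror !Z.opp_involutive.
have := right_time_back tau n tau_per v (v + n).
have := left_time_back tau n tau_per (v + n) v.
rewrite !Z.add_simpl_r; have ->: - (- v + n) = v - n by lia.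
lia.
Qed.

Lemma uncaught_mirror v w : v < w < v + n ->
  uncaught tau n v w -> uncaught (mirror tau) n (- w) (- v).
Proof.
move=> vw; rewrite /uncaught !left_time_mirror !right_time_mirror !Z.opp_involutive.
have ->: - (- w + n) = w - n by lia.
have ->: - (- v + n) = v - n by lia.
move=> [h1 h2 h3 h4].
have := right_time_back tau n tau_per v (v + n).
have := right_time_back tau n tau_per w (v + n).
have := right_time_back tau n tau_per w (w + n).
have := right_time_back tau n tau_per (v + n) (w + n).
have := left_time_back tau n tau_per (v + n) v.
have := left_time_back tau n tau_per w v.
have := left_time_back tau n tau_per (w + n) w.
have := left_time_back tau n tau_per (v + n) w.
rewrite !Z.add_simpl_r => *; split; lia.
Qed.

(* With [f] the edge times, this is [omega_gt]; mirrored it is [omega_lt]. *)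
Fixpoint front (f : Z -> Z) (v : Z) (t : nat) : nat :=
  if t is S t' then
    let k := front f v t' in
    if Z.of_nat t <? f (v + Z.of_nat k) then k else S k
  else O.

(** [front] inverts [right_time]: arrival times increase strictly, so a front gains at most one
    vertex per time unit, as in the recursion. *)
Lemma front_bounds f v t :
  right_time f v (v + Z.of_nat (front f v t)) <= Z.of_nat t <
  right_time f v (v + Z.of_nat (front f v t) + 1).
Proof.
elim: t => [|t IH].
  rewrite /= Z.add_0_r right_time_refl right_timeS ?right_time_refl; lia.
rewrite [front _ _ _]/=; set k := front f v t in IH *.
have := right_timeS f v (v + Z.of_nat k).
have := right_timeS f v (v + Z.of_nat k + 1).
case: Z.ltb_spec => [|] h; first lia.
have -> : v + Z.of_nat (S k) = v + Z.of_nat k + 1 by lia.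
lia.
Qed.

Lemma front_ge f v t u : v <= u -> right_time f v u <= Z.of_nat t ->
  u - v <= Z.of_nat (front f v t).
Proof.
move=> vu le; have := front_bounds f v t.
have := right_time_step f v (v + Z.of_nat (front f v t) + 1) u.
lia.
Qed.

(** Like [omega], this keeps growing after the fronts have covered the whole cycle. *)
Definition reach (f : Z -> Z) (v : Z) (t : nat) : Z :=
  1 + Z.of_nat (front f v t) + Z.of_nat (front (mirror f) (- v) t).

End Mirror.

Lemma front_ext f g v t : f =1 g -> front f v t = front g v t.
Proof. by move=> E; elim: t => //= t ->; rewrite E. Qed.

Lemma reach_mirror f v t : reach (mirror f) (- v) t = reach f v t.
Proof.
rewrite /reach Z.opp_involutive.
by rewrite (front_ext _ _ v t (mirrorK f)); lia.
Qed.

(** * Domination of one vertex by another *)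

Section Domination.
Variables (tau : Z -> Z) (n : Z).
Hypothesis n_gt0 : 0 < n.
Hypothesis tau_per : forall i, tau (i + n) = tau i.
Local Notation R := (right_time tau).
Local Notation L := (left_time tau).
Local Notation T := (arrival tau n).

Lemma front_shift f v t : (forall i, f (i + n) = f i) ->
  front f (v + n) t = front f v t.
Proof.
move=> per; elim: t => //= t ->.
have ->: v + n + Z.of_nat (front f v t) = v + Z.of_nat (front f v t) + n by lia.
by rewrite per.
Qed.

Lemma reach_shift v t : reach tau (v + n) t = reach tau v t.
Proof.
rewrite /reach front_shift // -(front_shift (mirror tau) (- (v + n))).
  by have ->: - (v + n) + n = - v by lia.
exact: mirror_per.
Qed.

(** A certificate that [w] is not at least as good as [v]: the containment at time [c] puts [c] at
    or after [tbar], and the step counts then favour [v] from [c] on, strictly at [c]. *)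
Definition dominates v w (c : nat) :=
  [/\ forall u, T w u <= Z.of_nat c -> T v u <= Z.of_nat c,
      forall t, (c <= t)%coq_nat -> reach tau w t <= reach tau v t
    & reach tau w c < reach tau v c].

(** At [c = L (w + n) (s + 1)] both left fronts wait for edge [s], so they coincide from then on,
    while the right front of [v] has not yet caught that of [w]. *)
Lemma left_catch_dominates v w e s :
  v < w < v + n -> w < e <= s + 1 -> w <= s < v + n -> R v e = R w e ->
  R w (e - 1) < R v (e - 1) < tau (e - 1) -> L (w + n) s = L (v + n) s ->
  L (v + n) (s + 1) < L (w + n) (s + 1) < tau s ->
  L (w + n) (s + 1) < R v (e - 1) -> exists c, dominates w v c.
Proof.
move=> vw he hs Ee he1 Es hs1 lt.
have C0 := left_time_ge tau (w + n) (s + 1).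
exists (Z.to_nat (L (w + n) (s + 1))).
have Lshift v' u : u <= v' -> L v' u = L (v' + n) (u + n).
  by move=> ?; rewrite left_time_shift.
have left_le t : L (w + n) (s + 1) <= Z.of_nat t ->
    Z.of_nat (front (mirror tau) (- v) t) + (w - v) <=
    Z.of_nat (front (mirror tau) (- w) t).
  move=> ht; have [+ _] := front_bounds (mirror tau) (- v) t.
  set k := Z.of_nat (front (mirror tau) (- v) t).
  rewrite right_time_mirror Z.opp_involutive Lshift; last lia.
  have -> : - (- v + k) + n = v + n - k by lia.
  move=> le; have := front_ge (mirror tau) (- w) t (- (v - k)).
  rewrite right_time_mirror !Z.opp_involutive Lshift; last lia.
  have -> : v - k + n = v + n - k by lia.
  have := left_time_merged tau (w + n) (v + n) s (v + n - k).
  have := left_time_step tau (w + n) (v + n - k) (s + 1).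
  lia.
have right_le t : Z.of_nat (front tau v t) - (w - v) <= Z.of_nat (front tau w t).
  case: (Z_lt_le_dec (v + Z.of_nat (front tau v t)) w) => h; first lia.
  have := front_bounds tau v t.
  have := front_ge tau w t (v + Z.of_nat (front tau v t)).
  have := right_time_anti tau v w (v + Z.of_nat (front tau v t)).
  lia.
split.
- move=> u; have [k [u0 [-> hu]]] := residue_cases n n_gt0 v u.
  rewrite !arrival_shift_mul Z2Nat.id; last lia.
  case: (Z_lt_le_dec u0 w) => h.
    rewrite (arrivalEl _ _ n_gt0 tau_per w); last lia.
    have := left_time_step tau (w + n) (v + n) (s + 1).
    have := left_time_step tau w u0 v.
    have := Lshift w v.
    lia.
  rewrite !arrivalE; try lia.
  have := right_time_anti tau v w u0.
  have := left_time_step tau (w + n) u0 (s + 1).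
  have := left_time_merged tau (w + n) (v + n) s u0.
  lia.
- move=> t ct; rewrite /reach.
  have := left_le t; have := right_le t; lia.
set c := Z.to_nat _; have cE : Z.of_nat c = L (w + n) (s + 1) by lia.
suff : Z.of_nat (front tau v c) - (w - v) < Z.of_nat (front tau w c).
  by rewrite /reach; have := left_le c; lia.
case: (Z_lt_le_dec (v + Z.of_nat (front tau v c)) w) => h; first lia.
have := front_bounds tau v c; rewrite cE.
move: h; set u := v + Z.of_nat (front tau v c) => h [h1 h2].
have ue : u < e - 1.
  case: (Z_lt_le_dec u (e - 1)) => // eu.
  have := right_time_step tau v (e - 1) u; lia.
have := front_ge tau w c (u + 1).
have := right_timeS tau v u; have := right_timeS tau w u.
have := right_time_apart tau v w u (e - 1).
have := right_time_apart tau v w (u + 1) (e - 1).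
lia.
Qed.

Lemma front_late f v t (per : forall i, f (i + n) = f i) :
  right_time f v (v + n) <= Z.of_nat t ->
  Z.of_nat (front f v t) = Z.of_nat t - right_time f v (v + n) + n.
Proof.
move=> ht; have := front_ge f v t (v + n).
have := front_bounds f v t; set k := Z.of_nat _ => hk kn.
have := right_time_late f n n_gt0 per v (v + k).
have := right_time_late f n n_gt0 per v (v + k + 1).
lia.
Qed.

(** After a full turn neither front waits again, so each gains exactly one vertex per time unit. *)
Lemma reach_late v t :
  R v (v + n) <= Z.of_nat t -> L (v + n) v <= Z.of_nat t ->
  reach tau v t = 1 + 2 * Z.of_nat t + 2 * n - turn_time tau n v.
Proof.
move=> hr hl; have := front_late tau v t tau_per hr.
have := front_late (mirror tau) (- v) t (mirror_per tau n tau_per).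
have -> : right_time (mirror tau) (- v) (- v + n) = L (v + n) v.
  rewrite right_time_mirror Z.opp_involutive.
  rewrite -(left_time_shift tau n tau_per) //; last lia.
  by congr left_time; lia.
by rewrite /reach /turn_time; lia.
Qed.

End Domination.

(** * Turn times and domination decide who wins more *)

Section Comparison.
Variables (tau : Z -> Z) (n : Z).
Hypothesis n_gt0 : 0 < n.
Hypothesis tau_per : forall i, tau (i + n) = tau i.
Local Notation R := (right_time tau).
Local Notation L := (left_time tau).

Lemma dominates_mirror v w c :
  dominates (mirror tau) n (- v) (- w) c -> dominates tau n v w c.
Proof.
move=> [h1 h2 h3]; split.
- move=> u; have := h1 (- u); rewrite !arrival_mirror //.
- by move=> t /h2; rewrite !reach_mirror.
- by move: h3; rewrite !reach_mirror.
Qed.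

Lemma dominates_shiftr v w c :
  dominates tau n v (w + n) c -> dominates tau n v w c.
Proof.
move=> [h1 h2 h3]; split.
- by move=> u; have := h1 u; rewrite arrival_shiftl.
- by move=> t /h2; rewrite reach_shift.
- by move: h3; rewrite reach_shift.
Qed.

(** The mirror image of [left_catch_dominates], shifted by [n]: the merging points [e] and [s]
    become [n - e] and [n - s] and exchange roles. *)
Lemma right_catch_dominates v w e s :
  v < w < v + n -> w < e <= s + 1 -> w <= s < v + n -> R v e = R w e ->
  R w (e - 1) < R v (e - 1) < tau (e - 1) -> L (w + n) s = L (v + n) s ->
  L (v + n) (s + 1) < L (w + n) (s + 1) < tau s ->
  R v (e - 1) < L (w + n) (s + 1) -> exists c, dominates tau n v w c.
Proof.
move=> vw he hs Ee he1 Es hs1 lt.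
have Rm p u : u <= p + n -> right_time (mirror tau) (- p) (n - u) = L (p + n) u.
  move=> ?; rewrite right_time_mirror Z.opp_involutive.
  have ->: - (n - u) = u - n by lia.
  by rewrite -(left_time_back tau n tau_per (p + n)) ?Z.add_simpl_r //; lia.
have Lm p u : p <= u -> left_time (mirror tau) (- p + n) (n - u) = R p u.
  move=> ?; rewrite left_time_mirror.
  have ->: - (n - u) = u - n by lia.
  have ->: - (- p + n) = p - n by lia.
  by rewrite (right_time_back tau n tau_per).
have s1 : n - s - 1 = n - (s + 1) by lia.
have e1 : n - e + 1 = n - (e - 1) by lia.
have ts : mirror tau (n - (s + 1)) = tau s.
  by rewrite /mirror -(tau_per (_ - 1)); congr tau; lia.
have te : mirror tau (n - e) = tau (e - 1).
  by rewrite /mirror -(tau_per (_ - 1)); congr tau; lia.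
have [||||||||c /dominates_mirror ?] := left_catch_dominates (mirror tau) n n_gt0
  (mirror_per tau n tau_per) (- w) (- v) (n - s) (n - e); last by exists c.
- by clear - vw; lia.
- by clear - he hs; lia.
- by clear - vw he hs; lia.
- by rewrite !Rm; lia.
- by rewrite s1 ts !Rm; lia.
- by rewrite !Lm; lia.
- by rewrite e1 te !Lm; lia.
- by rewrite e1 s1 Lm ?Rm; lia.
Qed.

Theorem wins_ge_of_undominated v w : v < w < v + n ->
  turn_time tau n v <= turn_time tau n w ->
  (forall c, ~ dominates tau n w v c) -> wins tau n w v <= wins tau n v w.
Proof.
move=> vw F nd.
have [t [_ _ h1 h2 _]] := wins_formula tau n n_gt0 tau_per v w vw.
have [Rv Rw Lv Lw] := two_arcs tau n tau_per v w vw.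
have Rvw := right_time_shift tau n tau_per v w ltac:(lia).
have Lwv := left_time_shift tau n tau_per w v ltac:(lia).
(* A front of [w] catching [v] shortens the turn of [w]; since [v] has no larger turn time, the
   opposite front of [v] must catch [w]. If nothing of [w] catches [v], the formula decides;
   otherwise [mutual_catch] and the lack of domination do. *)
have : (R w (w + n) <> R v w /\ L (w + n) w <> L (v + n) w) \/
  (R w (w + n) = R v w /\ L (v + n) v = L w v) \/
  (R v (v + n) = R w (v + n) /\ L (w + n) w = L (v + n) w).
  by clear - F Rv Rw Lv Lw vw; rewrite /turn_time in F; lia.
case=> [[n1 n2]|[[E1 E2]|[E1 E2]]].
- have {}h2 := h2 ltac:(lia) n2.
  by clear - F Rv Rw Lv Lw vw n1 n2 h1 h2; rewrite /turn_time in F; lia.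
- clear Rv Rw Lv Lw h1 h2.
  have [|||e [s [[he hs] [Ee he1] [Es hs1]]]] :=
    mutual_catch tau n n_gt0 tau_per w (v + n); try lia.
    by rewrite left_time_shift //; lia.
  rewrite wins_shiftr // wins_shiftl // => D.
  case: (Z_lt_le_dec (R w (e - 1)) (L (v + n + n) (s + 1))) => lt; last lia.
  have [||||||||c /dominates_shiftr /nd//] :=
    right_catch_dominates w (v + n) e s; try lia.
- clear Rv Rw Lv Lw h1 h2.
  have [|||e [s [[he hs] [Ee he1] [Es hs1] D]]] :=
    mutual_catch tau n n_gt0 tau_per v w; try lia.
  case: (Z_lt_le_dec (L (w + n) (s + 1)) (R v (e - 1))) => lt; last lia.
  have [||||||||c /nd//] :=
    left_catch_dominates tau n n_gt0 tau_per v w e s; try lia.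
Qed.

End Comparison.

(** * No response to [z] improves on [y] *)

Section SecondRound.
Variables (tau : Z -> Z) (n : Z).
Hypothesis n_gt0 : 0 < n.
Hypothesis tau_per : forall i, tau (i + n) = tau i.
Local Notation F := (turn_time tau n).
Local Notation W := (wins tau n).

Lemma second_round_right x y z : x < y -> y < z -> z < x + n ->
  (forall w, F x <= F w) -> W y x <= W x y -> (forall w, W w x <= W y x) ->
  (W z x = W y x -> W z y <= W y z) ->
  (forall w, W w y <= W z y) -> (forall w, W w y = W z y -> W w z <= W z w) ->
  W x y < W z y -> forall w, W w z <= W y z.
Proof.
move=> xy yz zx Hx Hxy Hy Hyz Hz Hzw lt w.
have [h1 h2 h3 h4 unc] :=
  three_points tau n n_gt0 tau_per x y z xy yz zx (Hx y) (Hx z) Hxy (Hy z) lt Hyz.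
case: (Z_le_gt_dec (W w z) (W y z)) => // gt; exfalso.
(* A [w] doing as well as [z] against [y] would satisfy [W w z <= W z w], but [w] wins more than
   half against [z]. *)
have E : W w y = W z y -> False.
  by move=> /Hzw; have := wins_sum tau n n_gt0 z w; lia.
have [k [w0 [Ew hw]]] := residue_cases n n_gt0 y w.
have Ws v : W w v = W w0 v.
  by have := wins_shift_mul tau n n_gt0 tau_per w0 v k 0; rewrite Z.add_0_r -Ew.
have Ws' v : W v w = W v w0.
  by have := wins_shift_mul tau n n_gt0 tau_per v w0 0 k; rewrite Z.add_0_r -Ew.
have Fw := Hx w0; have Hw0 := Hz w0; rewrite !Ws in E gt.
case: (Z.eq_dec w0 y) => [w0y|ny]; first by rewrite w0y in gt; lia.
case: (Z.eq_dec w0 z) => [w0z|nz].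
  by rewrite w0z (wins_refl tau n n_gt0) in gt; lia.
(* On either side of [z], [wins_le_dominating], applied directly with [y + n] or mirrored, makes [w]
   as good as [z] against [y]. *)
case: (Z_lt_le_dec w0 z) => wz.
  have := wins_le_dominating tau n n_gt0 tau_per w0 z (y + n).
  have := uncaught_shift tau n n_gt0 tau_per y z ltac:(lia) unc.
  rewrite !wins_shiftr // => u /(_ ltac:(lia) ltac:(lia) ltac:(lia) u).
  lia.
have := wins_le_dominating (mirror tau) n n_gt0 (mirror_per tau n tau_per)
  (- w0) (- z) (- y).
have := uncaught_mirror tau n n_gt0 tau_per y z ltac:(lia) unc.
rewrite !wins_mirror // !turn_time_mirror //.
move=> u /(_ ltac:(lia) ltac:(lia) ltac:(lia) u).
lia.
Qed.

End SecondRound.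

Theorem second_round tau n (n_gt0 : 0 < n) (tau_per : forall i, tau (i + n) = tau i)
    x y z (F := turn_time tau n) (W := wins tau n) :
  x < y < z /\ z < x + n \/ z < y < x /\ x < z + n ->
  (forall w, F x <= F w) -> W y x <= W x y -> (forall w, W w x <= W y x) ->
  (W z x = W y x -> W z y <= W y z) ->
  (forall w, W w y <= W z y) -> (forall w, W w y = W z y -> W w z <= W z w) ->
  W x y < W z y -> forall w, W w z <= W y z.
Proof.
case=> [[[xy yz] zx]|[[zy yx] xz]]; first exact: second_round_right.
move=> Hx Hxy Hy Hyz Hz Hzw lt w.
have Wm p q : wins (mirror tau) n p q = W (- p) (- q).
  by rewrite /W -(wins_mirror tau n n_gt0 tau_per) !Z.opp_involutive.
have Fm p : turn_time (mirror tau) n p = F (- p).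
  by rewrite /F -(turn_time_mirror tau n n_gt0 tau_per) Z.opp_involutive.
have := second_round_right (mirror tau) n n_gt0 (mirror_per tau n tau_per)
  (- x) (- y) (- z).
move=> /(_ ltac:(lia) ltac:(lia) ltac:(lia)).
have := Wm (- w) (- z); have := Wm (- y) (- z); rewrite !Z.opp_involutive => <- <-.
apply; rewrite ?Wm ?Fm ?Z.opp_involutive //.
- by move=> v; rewrite Fm.
- by move=> v; rewrite Wm Z.opp_involutive.
- by move=> v; rewrite Wm Z.opp_involutive.
- by move=> v; rewrite !Wm !Z.opp_involutive; apply: Hzw.
Qed.

(** * Transfer between the temporal cycle and the integer line *)

Lemma zcount_from_sum f a k :
  zcount_from f a k = Z.of_nat (\sum_(i < k) f (Z.add a (Z.of_nat i)))%N.
Proof.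
elim: k a => [|k IH] a; first by rewrite big_ord0.
rewrite big_ord_recl [LHS]/= IH Z.add_0_r Nat2Z.inj_add.
congr (_ + Z.of_nat _); first by case: (f a).
by apply: eq_bigr => i _; congr (nat_of_bool (f _)); rewrite lift0; lia.
Qed.

Section Bridge.
Variables (n : nat) (C : growing_tcycle n).
Local Notation N := (Z.of_nat n).
Implicit Types (u v w : 'Z_n) (t : nat) (a b : Z).

Let n_gt1 : (1 < n)%N := ltnW (tcycle_gt2 C).

Lemma cycle_length_gt0 : 0 < N.
Proof. by have := ltP n_gt1; lia. Qed.

Definition residue a : 'Z_n := ((Z.to_nat (Z.modulo a N))%:R)%R.
Definition zlift v : Z := Z.of_nat (nat_of_ord v).

Lemma zliftP v : 0 <= zlift v < N.
Proof.
rewrite /zlift; have := ltn_ord v; rewrite [X in (_ < X)%N]Zp_cast //.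
by move/ltP; lia.
Qed.

Lemma zliftK v : residue (zlift v) = v.
Proof.
by rewrite /residue Z.mod_small ?Nat2Z.id ?natr_Zp //; apply: zliftP.
Qed.

Lemma zlift_residue a : zlift (residue a) = Z.modulo a N.
Proof.
have := Z.mod_pos_bound a N cycle_length_gt0.
rewrite /zlift /residue val_Zp_nat //; set m := Z.modulo a N => hm.
have mn : (Z.to_nat m < n)%N by apply/ltP; lia.
by rewrite modn_small // Z2Nat.id; lia.
Qed.

Lemma residue_inj c a b : c <= a < c + N -> c <= b < c + N ->
  residue a = residue b -> a = b.
Proof.
move=> ha hb /(congr1 zlift); rewrite !zlift_residue => E.
have := Z_div_mod_eq_full a N; have := Z_div_mod_eq_full b N; rewrite E.
move: (Z.div a N) (Z.div b N) => q r.
by have [?|[->|?]] := Z.lt_trichotomy q r; nia.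
Qed.

Lemma residue_shift_mul a k : residue (a + k * N) = residue a.
Proof. by rewrite /residue Z_mod_plus_full. Qed.

Lemma residue_shift a : residue (a + N) = residue a.
Proof. by rewrite -(residue_shift_mul a 1); congr residue; lia. Qed.

Lemma residue_succ a : residue (a + 1) = (residue a + 1)%R.
Proof.
have N0 := cycle_length_gt0; have := Z.mod_pos_bound a N N0.
rewrite /residue -Zplus_mod_idemp_l; set m := Z.modulo a N => hm.
case: (Z.eq_dec (m + 1) N) => [E|ne].
  rewrite E Z_mod_same_full GRing.natr1.
  have ->: (Z.to_nat m).+1 = n by lia.
  by rewrite pchar_Zp.
rewrite Z.mod_small; last lia.
by rewrite GRing.natr1; congr (_%:R)%R; lia.
Qed.

Lemma residue_pred a : residue (a - 1) = (residue a - 1)%R.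
Proof.
have ->: residue a = (residue (a - 1) + 1)%R.
  by rewrite -residue_succ Z.sub_add.
by rewrite GRing.addrK.
Qed.

Lemma residueD a k : residue (a + Z.of_nat k) = (residue a + k%:R)%R.
Proof.
elim: k => [|k IH]; first by rewrite Z.add_0_r GRing.addr0.
rewrite Nat2Z.inj_succ -Z.add_1_r Z.add_assoc residue_succ IH.
by rewrite -GRing.addrA GRing.natr1.
Qed.

Lemma residueB a k : residue (a - Z.of_nat k) = (residue a - k%:R)%R.
Proof.
have ->: residue a = (residue (a - Z.of_nat k) + k%:R)%R.
  by rewrite -residueD Z.sub_add.
by rewrite GRing.addrK.
Qed.

Definition edge_time a : Z := Z.of_nat (tau C (residue a)).
Local Notation R := (right_time edge_time).
Local Notation L := (left_time edge_time).
Local Notation T := (arrival edge_time N).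

Lemma edge_time_shift a : edge_time (a + N) = edge_time a.
Proof. by rewrite /edge_time residue_shift. Qed.

Lemma edge_time_shift_mul a k : edge_time (a + k * N) = edge_time a.
Proof. by rewrite /edge_time residue_shift_mul. Qed.

Lemma cedge_snapshot t (i : 'Z_n) : (0 < t)%N ->
  (cedge i \in C t) = (tau C i <= t)%N.
Proof.
move=> t0; rewrite /tau; case: ex_minnP => m /andP[m0 mC] min.
apply/idP/idP => [it|mt]; first by apply: min; rewrite t0.
rewrite -(subnKC mt); elim: (t - m)%N => [|d IH]; first by rewrite addn0.
rewrite addnS; apply: (subsetP (tcycle_mono C _)) IH.
by rewrite addn_gt0 m0.
Qed.

Lemma cedge_neq (i : 'Z_n) : i != (i + 1)%R.
Proof.
rewrite -GRing.subr_eq0 GRing.opprD GRing.addNKr GRing.oppr_eq0.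
exact: GRing.oner_neq0.
Qed.

Lemma snapshot_step u v t : (0 < t)%N -> [set u; v] \in C t ->
  v = (u + 1)%R /\ (tau C u <= t)%N \/ v = (u - 1)%R /\ (tau C v <= t)%N.
Proof.
move=> t0 uvC.
have [i E] : exists i, [set u; v] = cedge i.
  by apply/(tcycle_union C); exists t.
have iC : (tau C i <= t)%N by rewrite -cedge_snapshot // -E.
have uv : u != v.
  apply/eqP => uv; have := cedge_neq i.
  have : i \in [set u; v] by rewrite E !inE eqxx.
  have : (i + 1)%R \in [set u; v] by rewrite E !inE eqxx orbT.
  by rewrite uv !inE !orbb => /eqP-> /eqP->; rewrite eqxx.
have : u \in cedge i by rewrite -E !inE eqxx.
have : v \in cedge i by rewrite -E !inE eqxx orbT.
rewrite !inE => /orP[]/eqP Ev /orP[]/eqP Eu.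
- by rewrite Eu Ev eqxx in uv.
- by right; rewrite Ev Eu GRing.addrK.
- by left; rewrite Ev Eu.
- by rewrite Eu Ev eqxx in uv.
Qed.

(** [T] grows along an edge no faster than any walk can, so a bound on [T] propagates along the walk
    once its vertices are lifted step by step. *)
Lemma walk_arrival a b t p :
  T a b <= Z.of_nat t -> path (tstep C) (residue b, t) p ->
  exists2 b', residue b' = (last (residue b, t) p).1
            & T a b' <= Z.of_nat (last (residue b, t) p).2.
Proof.
have N0 := cycle_length_gt0.
elim: p b t => [|[v t'] p IH] b t le /=; first by exists b.
move=> /andP[/andP[/= tt' bv] pp].
have /ltP t_t' := tt'.
have t'_gt0 : (0 < t')%N by exact: leq_ltn_trans tt'.
case: (snapshot_step _ _ _ t'_gt0 bv) => [[Ev ht]|[Ev ht]].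
- have [k [b0 [Eb hb]]] := residue_cases N N0 a b.
  have hd : edge_time b <= Z.of_nat t' by move/leP: ht; rewrite /edge_time; lia.
  rewrite -residue_succ in Ev; rewrite Ev in pp *; apply: IH pp.
  have := arrival_stepr edge_time N N0 a b0 hb.
  rewrite -(edge_time_shift_mul b0 k) -Eb -(arrival_shift_mul _ _ _ b0 k) -Eb.
  rewrite -(arrival_shift_mul _ _ _ (b0 + 1) k).
  have ->: b0 + 1 + k * N = b + 1 by lia.
  lia.
(* A left step needs [b0] in [(a, a + N]], hence the window starts at [a + 1]. *)
have [k [b0 [Eb hb]]] := residue_cases N N0 (a + 1) b.
rewrite -residue_pred in Ev; rewrite Ev in ht pp *.
have hd : edge_time (b - 1) <= Z.of_nat t' by move/leP: ht; rewrite /edge_time; lia.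
apply: IH pp; have := arrival_stepl edge_time N N0 a b0 ltac:(lia).
rewrite -(edge_time_shift_mul (b0 - 1) k) -(arrival_shift_mul _ _ _ b0 k) -Eb.
rewrite -(arrival_shift_mul _ _ _ (b0 - 1) k).
have ->: b0 - 1 + k * N = b - 1 by lia.
lia.
Qed.

Lemma twalk_rcons u v v' t t' p : twalk C u v t p -> (t < t')%N ->
  [set v; v'] \in C t' -> twalk C u v' t' (rcons p (v', t')).
Proof.
move=> [pP pl] tt' vv'; split; last by rewrite last_rcons.
by rewrite rcons_path pP pl /tstep /= tt'.
Qed.

Lemma right_walk a b : a <= b ->
  exists t p, twalk C (residue a) (residue b) t p /\ Z.of_nat t = R a b.
Proof.
move: b; apply: Zle_ind => [|b ab [t [p [wp Et]]]].
  by exists 0%N, [::]; rewrite right_time_refl.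
exists (maxn t.+1 (tau C (residue b))).
eexists; split; last first.
  rewrite right_timeS // -Et /edge_time /maxn; case: ltnP => /leP; lia.
apply: (twalk_rcons _ _ _ _ _ _ wp); first by rewrite leq_max ltnSn.
by rewrite residue_succ cedge_snapshot ?leq_maxr // leq_max.
Qed.

Lemma left_walk a b : b <= a ->
  exists t p, twalk C (residue a) (residue b) t p /\ Z.of_nat t = L a b.
Proof.
move: b; apply: Zge_ind => [|b ab [t [p [wp Et]]]].
  by exists 0%N, [::]; rewrite left_time_refl.
exists (maxn t.+1 (tau C (residue b))).
eexists; split; last first.
  have := left_timeS edge_time a (b + 1); rewrite Z.add_simpl_r => ->; last lia.
  rewrite -Et /edge_time /maxn; case: ltnP => /leP; lia.
apply: (twalk_rcons _ _ _ _ _ _ wp); first by rewrite leq_max ltnSn.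
rewrite residue_succ setUC.
by rewrite [_ \in _]cedge_snapshot ?leq_maxr // leq_max.
Qed.

Lemma td_arrival a b : Z.of_nat (td C (residue a) (residue b)) = T a b.
Proof.
have N0 := cycle_length_gt0.
rewrite /td; case: ex_minnP => m /asboolP[p [pP pl]] min.
have [k [b0 [Eb hb]]] := residue_cases N N0 a b.
have Erb : residue b = residue b0 by rewrite Eb residue_shift_mul.
rewrite Eb arrival_shift_mul; rewrite Erb in pl min.
apply: Z.le_antisymm.
  rewrite arrivalE //; last lia.
  have [|t [q [wq <-]]] := right_walk a b0; first lia.
  have [|t' [q' [wq' <-]]] := left_walk (a + N) b0; first lia.
  rewrite residue_shift in wq'.
  have /leP := min t (introT (asboolP _) (ex_intro _ q wq)).
  have /leP := min t' (introT (asboolP _) (ex_intro _ q' wq')).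
  lia.
have [|b' Eb' le] := walk_arrival a a 0 p _ pP.
  by rewrite arrival_refl.
rewrite pl /= in Eb' le.
have [k' [b1 [Eb1 hb1]]] := residue_cases N N0 a b'.
rewrite Eb1 arrival_shift_mul in le.
rewrite Eb1 residue_shift_mul in Eb'.
by rewrite (residue_inj a b0 b1).
Qed.

Lemma omega_reach t a : Z.of_nat (omega C t (residue a)) = reach edge_time a t.
Proof.
rewrite /omega /reach.
have ->: omega_gt C t (residue a) = front edge_time a t.
  elim: t => //= t ->; rewrite -residueD; move: (front _ _ _) => k.
  by case: ltnP => /leP h; case: Z.ltb_spec => //; rewrite /edge_time; lia.
have ->: omega_lt C t (residue a) = front (mirror edge_time) (- a) t.
  elim: t => //= t ->; rewrite -residueB -residue_pred; move: (front _ _ _) => k.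
  rewrite /mirror; have ->: - (- a + Z.of_nat k) - 1 = a - Z.of_nat k - 1 by lia.
  by case: ltnP => /leP h; case: Z.ltb_spec => //; rewrite /edge_time; lia.
by rewrite !Nat2Z.inj_add; lia.
Qed.

Lemma payoff_wins a b :
  Z.of_nat (payoff C (residue a) (residue b)) = wins edge_time N a b.
Proof.
rewrite /wins /zcount Z.sub_0_r Nat2Z.id zcount_from_sum.
congr Z.of_nat.
transitivity (\sum_(i < (Zp_trunc n).+2)
    Z.ltb (T a (Z.add 0 (Z.of_nat i))) (T b (Z.add 0 (Z.of_nat i))))%N.
  rewrite /payoff -sum1_card big_mkcond /=.
  apply: eq_bigr => i _; rewrite inE -/(zlift i).
  rewrite -!td_arrival zliftK.
  by case: ltnP => /leP h; case: Z.ltb_spec => //; lia.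
by rewrite Zp_cast.
Qed.

(** The tail of the colexicographic comparison bounds the turn times, and its start at [tbar]
    excludes domination. *)
Lemma paramount_wins a b : residue a <> residue b ->
  vsucceq C (residue a) (residue b) ->
  turn_time edge_time N a <= turn_time edge_time N b /\ wins edge_time N b a <= wins edge_time N a b.
Proof.
move=> ab succ; have N0 := cycle_length_gt0.
pose tb := tbar C (residue a) (residue b).
have late : exists M, forall t, (M <= t)%coq_nat ->
    reach edge_time b t <= reach edge_time a t.
  case: succ => [[i _ [_ h]]|h].
    exists i.+1 => t /leP /h /leP; rewrite -!omega_reach; lia.
  by exists tb => t /leP /h E; rewrite -!omega_reach E; lia.
have turn : turn_time edge_time N a <= turn_time edge_time N b.
  have [M hM] := late.
  (* Late enough for both vertices to have completed their turns, so that [reach_late] applies. *)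
  pose t := (M + Z.to_nat (R a (a + N) + L (a + N) a + R b (b + N) + L (b + N) b))%coq_nat.
  have h1 := right_time_ge edge_time a (a + N); have h2 := left_time_ge edge_time (a + N) a.
  have h3 := right_time_ge edge_time b (b + N); have h4 := left_time_ge edge_time (b + N) b.
  have : Z.of_nat t >= R a (a + N) + L (a + N) a + R b (b + N) + L (b + N) b.
    by rewrite /t; lia.
  have := hM t; have : (M <= t)%coq_nat by rewrite /t; lia.
  move: t => t Mt le ht; have := le Mt.
  by rewrite !(reach_late edge_time N N0 edge_time_shift); lia.
split=> //.
(* Domination gives [tb <= c]. A deciding index [i >= c] of the comparison contradicts [le] at [i];
   if [i < c], or if the sequences agree, [lt] fails at [c]. *)
have undom c : ~ dominates edge_time N b a c.
  case=> sub le lt; have cb : Defs.comparable C c (residue a) (residue b).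
    apply/orP; left; apply/subsetP => u; rewrite !inE -(zliftK u).
    move=> /leP hu; apply/leP; have := sub (zlift u).
    by rewrite -!td_arrival; lia.
  have tc : (tb <= c)%N by rewrite /tb /tbar; case: ex_minnP => m _; apply.
  case: succ => [[i ti [wi h]]|h].
    move: lt; rewrite -!omega_reach.
    case: (leqP c i) => [/leP/le|/h/leP]; rewrite -?omega_reach.
      by have /ltP : (omega C i (residue b) < omega C i (residue a))%N by []; lia.
    by cbv beta; lia.
  by move: lt; rewrite -!omega_reach h //; lia.
have [k [b0 [Eb hb]]] := residue_cases N N0 a b.
have ne : a <> b0 by move=> E; apply: ab; rewrite Eb residue_shift_mul E.
have Ws := wins_shift_mul edge_time N N0 edge_time_shift.
have := Ws a b0 0 k; have := Ws b0 a k 0.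
rewrite -Eb Z.mul_0_l Z.add_0_r => -> ->.
apply: (wins_ge_of_undominated edge_time N N0 edge_time_shift); first lia.
  by move: turn; rewrite Eb turn_time_shift_mul //; apply: edge_time_shift.
move=> c [h1 h2 h3]; apply: (undom c); split.
- by move=> u /h1; rewrite Eb (arrival_shiftl_mul edge_time N N0 edge_time_shift).
- by move=> t /h2; rewrite -!omega_reach Eb residue_shift_mul.
- by move: h3; rewrite -!omega_reach Eb residue_shift_mul.
Qed.

End Bridge.

Theorem theorem55 (n : nat) (C : growing_tcycle n) (x y z : 'Z_n)
    (hx : paramount C x)
    (hy : paramount_response C y x)
    (hz : paramount_response C z y) :
  nash C x y \/ nash C y z.
Proof.
have [bry ry] := hy; have [brz rz] := hz.
(* As [z] is a best response to [y], so is [x] whenever it does at least as well. *)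
case: (leqP (payoff C z y) (payoff C x y)) => [le|lt].
  by left; split=> // w; apply: leq_trans (brz w) le.
right; split=> // w.
have N0 := cycle_length_gt0 n C.
have pay0 v : payoff C v v = 0%N.
  by apply/eqP; rewrite cards_eq0; apply/eqP/setP => u; rewrite !inE ltnn.
have xy : x <> y.
  move=> xy; move: lt (bry z).
  by rewrite -xy pay0 leqn0 => /[swap] /eqP ->.
have zx : z <> x by move=> zx; rewrite zx ltnn in lt.
have zy : z <> y by move=> zy; rewrite zy pay0 in lt.
have tper := edge_time_shift n C.
pose W := wins (edge_time n C) (Z.of_nat n).
pose F := turn_time (edge_time n C) (Z.of_nat n).
have payE a b : Z.of_nat (payoff C (residue n a) (residue n b)) = W a b.
  exact: payoff_wins.
(* [y] and [z] are lifted to the turn starting at [x]; if [z] comes first, [x] is moved to the end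
   of that turn, so that the lift of [y] always lies in the middle. *)
have [a [b [c [Ea Eb Ec ord]]]] : exists a b c,
    [/\ residue n a = x, residue n b = y, residue n c = z
      & a < b < c /\ c < a + Z.of_nat n \/ c < b < a /\ a < c + Z.of_nat n].
  have ha := zliftP n C x; have hb := zliftP n C y; have hc := zliftP n C z.
  have ne u v : u <> v -> zlift n u <> zlift n v.
    by move=> uv E; apply: uv; rewrite -(zliftK n C u) E zliftK.
  have {}xy := ne _ _ xy; have {}zx := ne _ _ zx; have {}zy := ne _ _ zy.
  have up (u : 'Z_n) : exists u', [/\ residue n u' = u,
      u' = zlift n u \/ u' = zlift n u + Z.of_nat n & zlift n x <= u' < zlift n x + Z.of_nat n].
    have hu := zliftP n C u; case: (Z_lt_le_dec (zlift n u) (zlift n x)) => h.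
      by exists (zlift n u + Z.of_nat n); rewrite residue_shift zliftK //; split=> //; lia.
    by exists (zlift n u); rewrite zliftK //; split=> //; lia.
  have [b [Eb hb1 hb2]] := up y; have [c [Ec hc1 hc2]] := up z.
  case: (Z_lt_le_dec b c) => bc.
    by exists (zlift n x), b, c; rewrite zliftK //; split=> //; lia.
  exists (zlift n x + Z.of_nat n), b, c; rewrite residue_shift zliftK //.
  by split=> //; lia.
have nab : residue n a <> residue n b by rewrite Ea Eb.
have ncb : residue n c <> residue n b by rewrite Ec Eb.
have ltW : W a b < W c b by rewrite -!payE Ea Eb Ec; have := ltP lt; lia.
suff : W (zlift n w) c <= W b c.
  by rewrite -!payE zliftK // Eb Ec => h; apply/leP; lia.
have par v : residue n v <> x -> F a <= F v /\ W v a <= W a v.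
  move=> vx; apply: paramount_wins; rewrite Ea; first exact/nesym.
  by apply: hx; apply/eqP.
apply: (second_round (edge_time n C) (Z.of_nat n) N0 tper a b c ord) => [v||v|E|v|v E|//].
- have [vx|/eqP/par[]//] := eqVneq (residue n v) x.
  have [k [v0 [Ev hv]]] := residue_cases (Z.of_nat n) N0 a v.
  rewrite Ev residue_shift_mul -Ea in vx.
  rewrite Ev turn_time_shift_mul // (residue_inj n C a v0 a) //; lia.
- by apply: (proj2 (par b _)); rewrite Eb; apply/nesym.
- by rewrite -/W -!payE Ea Eb; have /leP := bry (residue n v); lia.
(* If [z] ties with [y] against [x], it is a best response to [x] too, and [y] was chosen at least
   as good. *)
- have [||//] := paramount_wins n C b c; first exact/nesym.
  rewrite Eb Ec; apply: ry => [|v]; first exact/eqP.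
  apply: leq_trans (bry v) _; apply/leP.
  by move: E; rewrite -/W -!payE Ea Eb Ec; lia.
- by rewrite -/W -!payE Ec Eb; have /leP := brz (residue n v); lia.
have [vz|/eqP vz] := eqVneq (residue n v) z.
  by rewrite -/W -!payE vz Ec pay0; lia.
have [||//] := paramount_wins n C c v; rewrite Ec; first exact/nesym.
apply: rz => [|u]; first exact/eqP.
apply: leq_trans (brz u) _; apply/leP.
by move: E; rewrite -/W -!payE Eb Ec; lia.
Qed.
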